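(* Assume the pressure assumption. The pair $(N^r,V^r)$ defined from the Burgers solution $w$ by $\lambda_k(N^r,V^r)=w$, $R_{-k}(N^r,V^r)=R_{-k}(n_-,u_-)$ on the rarefaction curve (see context) is an exact smooth planar solution of the effective Euler system $$\partial_tN+\mathrm{div}(NU)=0,\qquad \partial_tU+U\cdot\nabla U+\nabla q(N)=0,\qquad q'(N)=h_i'(N)+N^{-1}$$ (with $N=N^r$, $U=(V^r,0)$). It has the prescribed end states $(n_\pm,u_\pm)$ as $x_1\to\pm\infty$, stays in $[n_*,n^*]$ (i.e. $N^r\in[n_*,n^*]$), and, for each fixed $0\le t_0<T$, $$|(N^r,V^r)|_{\mathcal X_{s+3M+5,T}}\le C_{t_0,T}\,\delta .$$ The constant is uniform for end states in a fixed compact subset of the genuinely nonlinear rarefaction regime.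
   Context: Setting. Integers $s\ge5$, $M\ge0$ are fixed; $h_i'(n)=p_i'(n)/n$. Pressure assumption. There are $0<n_*<n^*$ and $I^\sharp=[n_*/4,2n^*]$ with $p_i\in C^{s+3M+6}(I^\sharp)$ and $p_i'\ge p_*>0$ on $I^\sharp$. The end densities $n_\pm$ lie in $(n_*,n^* )$. Put $c_q(N)=\sqrt{p_i'(N)+1}$ and $\lambda_\pm(N,V)=V\pm c_q(N)$, the eigenvalues of the one-dimensional effective Euler system in the variables $(N,V)$, with Riemann invariants $R_\pm(N,V)=V\pm\int^N c_q(z)z^{-1}\,dz$. The end states $(n_\pm,u_\pm)$ are joined by the rarefaction curve of a single genuinely nonlinear family $k\in\{-,+\}$ (along which $R_{-k}$ is constant and $\lambda_k$ is a smooth coordinate); its densities stay in a compact subinterval of $[n_*,n^*]$; and $\delta=|n_+-n_-|+|u_+-u_-|\le\delta_0$ for a fixed small $\delta_0$. Burgers datum. Let $w_\pm=\lambda_k(n_\pm,u_\pm)$, $\Delta w=w_+-w_->0$, and let $w_0\in C^\infty(\mathbb R)$ be monotone with $w_0(\pm\infty)=w_\pm$, $w_0'\ge0$, $w_0'\in H^{s+3M+5}(\mathbb R)$, and exponential tails $|\partial_1^j(w_0-w_\pm)|\le C_j\Delta w\,e^{-c|x_1|}$ on $\{\pm x_1\ge0\}$ for $0\le j\le s+3M+6$ (for example an affine rescaling of $\tanh x_1$). $w$ is the global smooth solution of $\partial_tw+w\partial_1w=0$, $w(0,x_1)=w_0(x_1)$, given by $w(t,x_1)=w_0(\xi)$,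 $x_1=\xi+tw_0(\xi)$. Profile seminorm. For $f=f(t,x_1)$, $|f|_{\mathcal X_{m,T}}=\sum_{a+b\le m}\sup_{t_0\le t\le T}\|\partial_t^a\partial_1^bf(t)\|_{L^\infty(\mathbb R)}+\sum_{a+b\le m}\|\partial_t^a\partial_1^{b+1}f\|_{L^2([t_0,T]\times\mathbb R)}$.
   Formalization: The constant is uniform on compact sets of pairs of end states with w_- < w_+, so δ is bounded below there; uniformity as δ→0 fails because the seminorm contains sup|N^r| ≥ n_*. ''Smooth coordinate'' is assumed as a C^{s+3M+6} inverse of λ_k. *)

(* Defs.v *)
From HB Require Import structures.
From mathcomp Require Import all_boot all_order all_algebra.
From mathcomp Require Import all_classical all_reals all_analysis.

Set Implicit Arguments.
Unset Strict Implicit.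
Unset Printing Implicit Defensive.

Import Order.TTheory GRing.Theory Num.Theory.
Import numFieldNormedType.Exports.

Local Open Scope classical_set_scope.
Local Open Scope ring_scope.

Section Regularity.
Context {R : realType}.

Definition Ck (r : nat) (g : R -> R) : Prop :=
  (forall j x, (j < r)%N -> derivable (derive1n j g) x 1) /\
  (forall j, (j <= r)%N -> continuous (derive1n j g)).

(* C^r of the closed interval [a, b], as restrictions of C^r functions on R;
   f itself may be arbitrary outside [a, b]. *)
Definition Ck_itv (r : nat) (a b : R) (f : R -> R) : Prop :=
  exists2 g : R -> R, Ck r g & {in `[a, b], f =1 g}.

(* Evolution takes place on t >= 0 only: difference quotients in time are
   restricted to the half line, so that the derivative at t = 0 is the right
   derivative and, at t > 0, the usual two-sided one. *)
Definition tquot (g : R -> R) (t : R) : set_system R :=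
  (fun h : R => h^-1 * (g (t + h) - g t)) @ within [set h | 0 <= t + h] 0^'.

Definition tderivable (g : R -> R) (t : R) : Prop := cvg (tquot g t).
Definition tderive (g : R -> R) (t : R) : R := lim (tquot g t).

Definition dt (f : R -> R -> R) : R -> R -> R := fun t x => tderive (f^~ x) t.
Definition dx (f : R -> R -> R) : R -> R -> R := fun t x => derive1 (f t) x.
Definition dtx (a b : nat) (f : R -> R -> R) : R -> R -> R :=
  iter a dt (iter b dx f).

(* C^r of [0, +oo[ x R. *)
Fixpoint Ck_strip (r : nat) (f : R -> R -> R) : Prop :=
  {within [set z : R * R | 0 <= z.1], continuous (fun z => f z.1 z.2)} /\
  match r with
  | 0 => True
  | r'.+1 =>
    [/\ forall t x, 0 <= t -> tderivable (f^~ x) t /\ derivable (f t) x 1,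
        Ck_strip r' (dt f) & Ck_strip r' (dx f)]
  end.

End Regularity.

Section ProfileSeminorm.
Context {R : realType}.
Local Notation mu := (@lebesgue_measure R).
Local Open Scope ereal_scope.

Definition Xnorm (m : nat) (t0 T : R) (f : R -> R -> R) : \bar R :=
  \sum_(ab : 'I_m.+1 * 'I_m.+1 | (ab.1 + ab.2 <= m)%N)
     ereal_sup [set 'N[mu]_+oo[EFin \o dtx ab.1 ab.2 f t] | t in `[t0, T]]
  + \sum_(ab : 'I_m.+1 * 'I_m.+1 | (ab.1 + ab.2 <= m)%N)
     'N[mu \x mu]_2%:E[EFin \o
        ((fun z : R * R => dtx ab.1 ab.2.+1 f z.1 z.2) \_ (`[t0, T] `*` setT))].

Definition Xnorm2 (m : nat) (t0 T : R) (f g : R -> R -> R) : \bar R :=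
  Xnorm m t0 T f + Xnorm m t0 T g.

End ProfileSeminorm.

Section EffectiveEuler.
Context {R : realType}.

(* The lower bound is stated on the interior of I^# = [nlo/4, 2 nhi], where
   derive1 sees only values of p on I^#; by continuity of p' this is the bound
   on all of I^#. *)
Definition pressure_assumption (r : nat) (nlo nhi plo : R) (p : R -> R) : Prop :=
  [/\ 0 < nlo, nlo < nhi, 0 < plo, Ck_itv r (nlo / 4) (2 * nhi) p
    & {in `]nlo / 4, 2 * nhi[, forall n, plo <= derive1 p n}].

Definition enthalpy' (p : R -> R) (n : R) : R := derive1 p n / n.

(* q is a primitive of h_i'(n) + 1/n on the interior of I^#. *)
Definition effective_enthalpy (nlo nhi : R) (p q : R -> R) : Prop :=
  {in `]nlo / 4, 2 * nhi[,
     forall n, is_derive n (1 : R) q (enthalpy' p n + n^-1)}.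

(* Families: true is "+", false is "-". *)
Definition sgn (k : bool) : R := if k then 1 else -1.

Definition cq (p : R -> R) (n : R) : R := Num.sqrt (derive1 p n + 1).

(* States are pairs z = (N, V). *)
Definition lambda (p : R -> R) (k : bool) (z : R * R) : R :=
  z.2 + sgn k * cq p z.1.

(* The base point nlo of the integral is a normalization; used for
   nlo <= z.1 only. *)
Definition riemann (p : R -> R) (nlo : R) (k : bool) (z : R * R) : R :=
  z.2 + sgn k * \int[lebesgue_measure]_(y in `[nlo, z.1]) (cq p y / y).

(* Right eigenvector, for the eigenvalue lambda p k (N, V), of the matrix
   ((V, N), (q'(N), V)) of the one-dimensional system. *)
Definition eigenvector (p : R -> R) (k : bool) (z : R * R) : R * R :=
  (z.1, sgn k * cq p z.1).

Definition genuinely_nonlinear_at (p : R -> R) (k : bool) (z : R * R) : Prop :=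
  'D_(eigenvector p k z) (lambda p k) z != 0.

(* The arc of the k-rarefaction curve through zm lying over the densities
   between those of zm and zp: with zm.1 and zp.1 in ]nlo, nhi[, its densities
   fill a compact subinterval of [nlo, nhi]. *)
Definition rarefaction_curve (p : R -> R) (nlo : R) (k : bool)
    (zm zp : R * R) : set (R * R) :=
  [set z | z.1 \in `[Num.min zm.1 zp.1, Num.max zm.1 zp.1] /\
           riemann p nlo (~~ k) z = riemann p nlo (~~ k) zm].

(* lambda_k is a coordinate on the curve, with a C^r inverse (g1, g2).  It is
   used with r = s + 3M + 6.  This is one order more than follows from
   p in C^r and genuine nonlinearity, since lambda_k involves p', and it is the
   number of derivatives of (N, V) occurring in the profile seminorm. *)
Definition smooth_coordinate (r : nat) (p : R -> R) (nlo : R) (k : bool)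
    (zm zp : R * R) : Prop :=
  exists g1 g2 : R -> R,
  [/\ Ck_itv r (lambda p k zm) (lambda p k zp) g1,
      Ck_itv r (lambda p k zm) (lambda p k zp) g2,
      {in `[lambda p k zm, lambda p k zp], forall y,
         rarefaction_curve p nlo k zm zp (g1 y, g2 y) /\
         lambda p k (g1 y, g2 y) = y}
    & forall z, rarefaction_curve p nlo k zm zp z ->
        lambda p k z \in `[lambda p k zm, lambda p k zp] /\
        z = (g1 (lambda p k z), g2 (lambda p k z))].

(* The genuinely nonlinear rarefaction regime, as a set of pairs of end states
   (zm, zp) = ((n_-, u_-), (n_+, u_+)).  The last inequality is strict, so
   |zp - zm| is bounded below on compact subsets; this is needed for a uniform
   bound linear in the strength, as Xnorm contains the sup norm of f itself. *)
Definition rarefaction_regime (r : nat) (p : R -> R) (nlo nhi : R) (k : bool) :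
    set ((R * R) * (R * R)) :=
  [set e | let: (zm, zp) := e in
    [/\ nlo < zm.1 < nhi /\ nlo < zp.1 < nhi,
        rarefaction_curve p nlo k zm zp zp,
        forall z, rarefaction_curve p nlo k zm zp z ->
          genuinely_nonlinear_at p k z,
        smooth_coordinate r p nlo k zm zp
      & lambda p k zm < lambda p k zp]].

Definition strength (zm zp : R * R) : R :=
  `|zp.1 - zm.1| + `|zp.2 - zm.2|.

(* m = s + 3M + 5.  As w0 is smooth, w0' belongs to H^m iff its classical
   derivatives up to order m are square integrable. *)
Definition burgers_datum (m : nat) (c : R) (C : nat -> R) (wm wp : R)
    (w0 : R -> R) : Prop :=
  [/\ forall n, Ck n w0,
      {homo w0 : x y / x <= y} /\ forall x, 0 <= derive1 w0 x,
      w0 x @[x --> -oo] --> wm /\ w0 x @[x --> +oo] --> wp,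
      forall j, (j <= m)%N ->
        ('N[@lebesgue_measure R]_2%:E[EFin \o derive1n j.+1 w0] < +oo)%E
    & forall j x, (j <= m.+1)%N ->
        (0 <= x -> `|derive1n j (fun y => w0 y - wp) x|
                     <= C j * (wp - wm) * expR (- (c * `|x|))) /\
        (x <= 0 -> `|derive1n j (fun y => w0 y - wm) x|
                     <= C j * (wp - wm) * expR (- (c * `|x|)))].

Definition burgers_solution (w0 : R -> R) (w : R -> R -> R) : Prop :=
  [/\ forall n, Ck_strip n w,
      forall t x, 0 <= t -> dt w t x + w t x * dx w t x = 0,
      forall x, w 0 x = w0 x
    & forall t xi, 0 <= t -> w t (xi + t * w0 xi) = w0 xi].

Definition rarefaction_profile (p : R -> R) (nlo : R) (k : bool)
    (zm zp : R * R) (w N V : R -> R -> R) : Prop :=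
  forall t x, 0 <= t ->
    rarefaction_curve p nlo k zm zp (N t x, V t x) /\
    lambda p k (N t x, V t x) = w t x.

Definition pd (d : nat) (j : 'I_d) (f : 'rV[R]_d -> R) (x : 'rV[R]_d) : R :=
  'D_(delta_mx 0 j) f x.

(* Classical solutions on [0, +oo[ x R^d. *)
Definition euler_solution (d : nat) (q : R -> R) (N : R -> 'rV[R]_d -> R)
    (U : R -> 'rV[R]_d -> 'rV[R]_d) : Prop :=
  forall (t : R) (x : 'rV[R]_d), 0 <= t ->
  [/\ tderivable (N^~ x) t /\ differentiable (N t) x,
      forall i, tderivable (fun t' => U t' x 0 i) t /\
                differentiable (fun y => U t y 0 i) x,
      differentiable (fun y => q (N t y)) x,
      tderive (N^~ x) t + \sum_j pd j (fun y => N t y * U t y 0 j) x = 0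
    & forall i, tderive (fun t' => U t' x 0 i) t
                + \sum_j U t x 0 j * pd j (fun y => U t y 0 i) x
                + pd i (fun y => q (N t y)) x = 0].

Definition planar_density (d : nat) (N : R -> R -> R) (t : R)
    (x : 'rV[R]_d.+1) : R := N t (x 0 0).

Definition planar_velocity (d : nat) (V : R -> R -> R) (t : R)
    (x : 'rV[R]_d.+1) : 'rV[R]_d.+1 :=
  \row_i (if i == 0 then V t (x 0 0) else 0).

(* m = s + 3M + 5. *)
Definition rarefaction_data (m : nat) (p : R -> R) (nlo nhi : R) (k : bool)
    (delta0 c : R) (C : nat -> R) (zm zp : R * R) (w0 : R -> R)
    (w N V : R -> R -> R) : Prop :=
  [/\ rarefaction_regime m.+1 p nlo nhi k (zm, zp),
      strength zm zp <= delta0,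
      burgers_datum m c C (lambda p k zm) (lambda p k zp) w0,
      burgers_solution w0 w
    & rarefaction_profile p nlo k zm zp w N V].

End EffectiveEuler.

(* Main.v *)
(* The profile is N = G1(w), V = G2(w), where (G1, G2) inverts lambda_k on the
   arc and w is the Burgers solution.  Since V = const +- Phi(N) with
   Phi' = c_q / N, and N_t = - w N_x, V_t = - w V_x with w = V +- c_q(N), both
   Euler equations reduce to q'(N) = c_q(N)^2 / N.

   For the seminorm, let xi = x - t w be the foot of the characteristic and
   J = xi_x = 1 / (1 + t w0'(xi)), which lies in (0, 1] as w0' >= 0.  The
   derivatives of w are polynomials in t, w, J and w0^(j)(xi), each monomial
   with a factor w0^(j)(xi), j >= 1; as |xi| >= |x| - T sup|w|, they decay like
   exp(-c|x|), uniformly for t in [0, T].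

   The derivatives of G1, G2 are bounded uniformly on a compact set K of end
   states, because the coordinates of two arcs of K with overlapping
   densities agree up to translations, so that the bounds for at most three
   arcs of K serve a whole neighbourhood of a point of K. Finally |zp - zm|
   is bounded below on K, so a uniform bound is also linear in the strength. *)

Require Import Defs.
From HB Require Import structures.
From mathcomp Require Import all_boot all_order all_algebra.
From mathcomp Require Import all_classical all_reals all_analysis.
From mathcomp Require Import measurable_realfun ess_sup_inf hoelder ring lra.

Set Implicit Arguments.
Unset Strict Implicit.
Unset Printing Implicit Defensive.

Import Order.TTheory GRing.Theory Num.Theory.
Import numFieldNormedType.Exports.

Local Open Scope classical_set_scope.
Local Open Scope ring_scope.

(** * One-sided time derivatives *)

Section TimeDerivative.
Context {R : realType}.
Implicit Types (f g : R -> R) (t l : R).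

Definition forward (t : R) : set_system R := within [set h | 0 <= t + h] 0^'.

Global Instance forward_filter t : Filter (forward t).
Proof. exact: within_filter. Qed.

(** Small positive increments are always admissible when t >= 0. Properness makes limits along this
    filter unique, which is what allows [tderive] to be computed from a limit. *)
Lemma forward_proper t : 0 <= t -> ProperFilter (forward t).
Proof.
move=> t0; apply: Build_ProperFilter_ex => A [e /= e0 H].
have e2 : 0 < e / 2 by rewrite divr_gt0.
exists (e / 2); apply: H => /=.
- by rewrite sub0r normrN gtr0_norm// ltr_pdivrMr// ltr_pMr// ltr1n.
- by rewrite gt_eqF.
- by rewrite addr_ge0// ltW.
Qed.

Lemma near_forward t (P : R -> Prop) :
  (\forall h \near 0^', 0 <= t + h -> P h) -> \forall h \near forward t, P h.
Proof. by []. Qed.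

Lemma tderiveP g t l : 0 <= t -> tquot g t --> l ->
  tderivable g t /\ tderive g t = l.
Proof.
move=> t0 H; have PF := forward_proper t0.
by split; [apply/cvg_ex; exists l | apply: cvg_lim].
Qed.

Lemma tquot_tderive g t : tderivable g t -> tquot g t --> tderive g t.
Proof. by []. Qed.

Lemma eq_tquot f g t l : 0 <= t -> (forall s, 0 <= s -> f s = g s) ->
  tquot f t --> l -> tquot g t --> l.
Proof.
move=> t0 fg; apply: cvg_trans; apply: near_eq_cvg.
apply: (near_forward (t := t)); near=> h => th; rewrite !fg.
Unshelve. all: by end_near. Qed.

Lemma tquot_eq g t (a b : R) : tquot g t --> a -> a = b -> tquot g t --> b.
Proof. by move=> + <-. Qed.

Lemma tquot_cst (a : R) t : tquot (cst a) t --> (0 : R).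
Proof.
rewrite /tquot; under eq_fun do rewrite subrr mulr0.
exact: cvg_cst.
Qed.

Lemma tquot_id t : tquot id t --> (1 : R).
Proof.
have := cvg_cst (1 : R) => /(_ _ (forward t) _).
apply: cvg_trans; apply: near_eq_cvg; apply: (near_forward (t := t)).
near=> h => _ /=; rewrite addrAC subrr add0r mulVf//.
by near: h; exact: nbhs_dnbhs_neq.
Unshelve. all: by end_near. Qed.

(** For h != 0, g(t + h) is h times the difference quotient plus g(t), and the first term tends to
    0. *)
Lemma tquot_continuous g t l : tquot g t --> l ->
  g (t + h) @[h --> forward t] --> g t.
Proof.
move=> H.
have h0 : h @[h --> forward t] --> (0 : R).
  by move=> A A0; apply: cvg_within; exact: nbhs_dnbhs.
have := cvgD (cvgM h0 H) (cvg_cst (g t)).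
move=> /(_ _ _ _); rewrite mul0r add0r.
apply: cvg_trans; apply: near_eq_cvg.
apply: (near_forward (t := t)); near=> h => _; rewrite !fctE /=.
by rewrite mulrA divff ?mul1r ?subrK//; near: h; exact: nbhs_dnbhs_neq.
Unshelve. all: by end_near. Qed.

Lemma tquotD f g t (a b : R) : tquot f t --> a -> tquot g t --> b ->
  tquot (f \+ g) t --> a + b.
Proof.
move=> Hf Hg; have := cvgD Hf Hg.
move=> /(_ _); apply: cvg_trans; apply: near_eq_cvg.
by near=> h; rewrite !fctE /=; ring.
Unshelve. all: by end_near. Qed.

Lemma tquotM f g t (a b : R) : tquot f t --> a -> tquot g t --> b ->
  tquot (f \* g) t --> a * g t + f t * b.
Proof.
move=> Hf Hg; have Cg := tquot_continuous Hg.
have := cvgD (cvgM Hf Cg) (cvgM (cvg_cst (f t)) Hg).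
move=> /(_ _ _ _ _ _); apply: cvg_trans; apply: near_eq_cvg.
by near=> h; rewrite !fctE /=; ring.
Unshelve. all: by end_near. Qed.

(** Chain rule with a one-sided inner and a two-sided outer derivative: the increment of [g] may
    have either sign even at t = 0. *)
Lemma tquot_comp (phi g : R -> R) t (a b : R) : tquot g t --> a ->
  is_derive (g t) 1 phi b -> tquot (phi \o g) t --> b * a.
Proof.
move=> Hg [dphi <-{b}]; set b := 'D_1 phi (g t).
(* The slope of [phi] is extended continuously by b at 0, so the factorization of the quotient
   survives increments at which [g] does not change. *)
pose sl (k : R) := if k == 0 then b else k^-1 * (phi (k + g t) - phi (g t)).
have csl : sl k @[k --> 0] --> b.
  move=> A Ab; rewrite /= dnbhsE; split; last first.
    by apply/principal_filterP; rewrite /= /sl eqxx; exact: nbhs_singleton.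
  have Aphi : \forall k \near (0 : R)^',
      A (k^-1 *: (phi (k *: 1 + g t) - phi (g t))) by exact: dphi _ Ab.
  change (\forall k \near (0 : R)^', A (sl k)).
  apply: filterS2 _ Aphi (nbhs_dnbhs_neq (0 : R)) => k.
  by move=> Ak k0; rewrite /sl (negbTE k0); rewrite [k *: 1]mulr1 in Ak.
have H0 : g (t + h) - g t @[h --> forward t] --> (0 : R).
  rewrite -(subrr (g t)); apply: cvgB; last exact: cvg_cst.
  exact: tquot_continuous Hg.
have : sl (g (t + h) - g t) @[h --> forward t] --> b.
  exact: (cvg_comp _ _ H0 csl).
move=> /cvgM/(_ Hg); apply: cvg_trans.
apply: near_eq_cvg; near=> h => /=; rewrite /sl.
case: eqVneq => [/eqP|gne].
  by rewrite subr_eq0 => /eqP ->; rewrite !subrr !mulr0.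
rewrite subrK mulrAC mulrCA mulrA; congr (_ * _).
by rewrite -mulrA mulVf// mulr1.
Unshelve. all: by end_near. Qed.

End TimeDerivative.

(** * Families with uniformly dominated derivatives *)

Section DominatedFamilies.
Context {R : realType} {I : Type}.
Variable T : R.
Implicit Types (f g u : I -> R -> R -> R) (e : R -> R).

Definition strip_continuous (f : R -> R -> R) : Prop :=
  {within [set z : R * R | 0 <= z.1], continuous (fun z => f z.1 z.2)}.

Definition dominated e f : Prop := exists B : R, forall i (t x : R),
  0 <= t <= T -> `|f i t x| <= B * e x.

(* The bound is uniform over the index i and over 0 <= t <= T, while regularity
   is required for all t >= 0; the weight e is either 1 or an exponential. *)
Fixpoint Ck_dominated (r : nat) e f : Prop :=
  [/\ forall i, strip_continuous (f i), dominated e f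
    & match r with
      | 0 => True
      | r'.+1 =>
        [/\ forall i t x, 0 <= t ->
              tderivable ((f i)^~ x) t /\ derivable (f i t) x 1,
            Ck_dominated r' e (fun i => dt (f i))
          & Ck_dominated r' e (fun i => dx (f i))]
      end].

Lemma Ck_dominated_strip r e f i : Ck_dominated r e f -> Ck_strip r (f i).
Proof.
elim: r f => [|r IH] f /=; first by move=> [cf _ _]; split=> //; exact: cf.
move=> [cf _ [df /IH ft /IH fx]]; split; first exact: cf.
by split=> // t x; exact: df.
Qed.

Lemma eq_strip_continuous (f g : R -> R -> R) :
  (forall t x, 0 <= t -> f t x = g t x) ->
  strip_continuous f -> strip_continuous g.
Proof.
move=> fg; apply: subspace_eq_continuous => z; rewrite inE/= => z0.
exact: fg.
Qed.

Lemma strip_continuous_comp (f : R -> R -> R) (g : R -> R) :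
  strip_continuous f -> continuous g ->
  strip_continuous (fun t x => g (f t x)).
Proof.
move=> cf cg z.
exact: (@cvg_comp _ _ _ (fun z : R * R => f z.1 z.2) g _ _ _ (cf z) (cg _)).
Qed.

Lemma eq_tquot_dt (f g : R -> R -> R) t x : 0 <= t ->
  (forall t x, 0 <= t -> f t x = g t x) ->
  tderivable (f^~ x) t -> tderivable (g^~ x) t /\ dt g t x = dt f t x.
Proof.
move=> t0 fg /tquot_tderive df; apply: tderiveP => //.
by apply: eq_tquot df => // s s0; exact: fg.
Qed.

Lemma eq_dx (f g : R -> R -> R) t : (forall x, f t x = g t x) ->
  forall x, (derivable (f t) x 1 -> derivable (g t) x 1) /\ dx g t x = dx f t x.
Proof. by move=> /funext fg x; rewrite /dx fg. Qed.

(** Admissible increments keep t + h nonnegative, so [dt] at t >= 0 does not see values at negative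
    times, and the induction can go on with [dt] and [dx]. *)
Lemma eq_Ck_dominated r e f g :
  (forall i t x, 0 <= t -> f i t x = g i t x) ->
  Ck_dominated r e f -> Ck_dominated r e g.
Proof.
elim: r f g => [|r IH] f g fg /= [cf [B Bf] df].
  split=> [i||//]; first by apply: eq_strip_continuous (cf i) => t x; exact: fg.
  by exists B => i t x t0T; rewrite -fg; [exact: Bf|case/andP: t0T].
split=> [i||]; first by apply: eq_strip_continuous (cf i) => t x; exact: fg.
  by exists B => i t x t0T; rewrite -fg; [exact: Bf|case/andP: t0T].
case: df => df ft fx; split.
- move=> i t x t0; have [dft dfx] := df i t x t0; split.
    by have [] := eq_tquot_dt t0 (fg i) dft.
  by apply: (eq_dx (fun x => fg i t x t0) x).1.
- apply: IH ft => i t x t0; have [dft _] := df i t x t0.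
  by have [_ ->] := eq_tquot_dt t0 (fg i) dft.
- by apply: IH fx => i t x t0; rewrite (eq_dx (fun x => fg i t x t0) x).2.
Qed.

(** Lets explicit formulas stand for the derivatives. They need to match [dt] and [dx] only for t >=
    0. *)
Lemma Ck_dominatedS r e f ft fx :
  (forall i, strip_continuous (f i)) -> dominated e f ->
  (forall i t x, 0 <= t -> tquot ((f i)^~ x) t --> ft i t x) ->
  (forall i t x, 0 <= t -> is_derive x (1 : R) (f i t) (fx i t x)) ->
  Ck_dominated r e ft -> Ck_dominated r e fx -> Ck_dominated r.+1 e f.
Proof.
move=> cf Bf dft dfx kft kfx; split=> //; split.
- move=> i t x t0; split; last by have [] := dfx i t x t0.
  by have [] := tderiveP t0 (dft i t x t0).
- apply: eq_Ck_dominated kft => i t x t0.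
  by have [_ <-] := tderiveP t0 (dft i t x t0).
- apply: eq_Ck_dominated kfx => i t x t0.
  by rewrite /dx derive1E; have [_ ->] := dfx i t x t0.
Qed.

Lemma Ck_dominated_cont r e f i : Ck_dominated r e f -> strip_continuous (f i).
Proof. by case: r => [|r] []. Qed.

Lemma Ck_dominated_bound r e f : Ck_dominated r e f -> dominated e f.
Proof. by case: r => [|r] []. Qed.

Lemma Ck_dominatedW r r' e f : (r' <= r)%N ->
  Ck_dominated r e f -> Ck_dominated r' e f.
Proof.
elim: r r' f => [|r IH] [|r'] f //=; first by move=> _ [].
by move=> rr [cf Bf [df /(IH _ _ rr) ft /(IH _ _ rr) fx]].
Qed.

Lemma dominated_weight e e' f : (forall x, 0 <= e x <= e' x) ->
  dominated e f -> dominated e' f.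
Proof.
move=> ee [B Bf]; exists `|B| => i t x /Bf /le_trans; apply.
have /andP[e0 ee'] := ee x.
by rewrite (le_trans (ler_wpM2r e0 (ler_norm B)))// ler_wpM2l.
Qed.

Lemma Ck_dominated_weight r e e' f : (forall x, 0 <= e x <= e' x) ->
  Ck_dominated r e f -> Ck_dominated r e' f.
Proof.
move=> ee; elim: r f => [|r IH] f /= [cf Bf df].
  by split=> //; exact: dominated_weight Bf.
split=> //; first exact: dominated_weight Bf.
by case: df => df /IH ? /IH ?.
Qed.

Lemma Ck_dominatedD r e f g : Ck_dominated r e f -> Ck_dominated r e g ->
  Ck_dominated r e (fun i t x => f i t x + g i t x).
Proof.
have cD f' g' : (forall i, strip_continuous (f' i)) ->
    (forall i, strip_continuous (g' i)) -> forall i,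
    strip_continuous (fun t x => f' i t x + g' i t x).
  by move=> cf cg i z; apply: cvgD; [exact: cf|exact: cg].
have bD f' g' : dominated e f' -> dominated e g' ->
    dominated e (fun i t x => f' i t x + g' i t x).
  move=> [B Bf] [B' Bg]; exists (B + B') => i t x t0T.
  by rewrite (le_trans (ler_normD _ _))// mulrDl lerD// ?Bf ?Bg.
elim: r f g => [|r IH] f g [cf Bf df] [cg Bg dg].
  by split=> //; [exact: cD|exact: bD].
case: df => df ft fx; case: dg => dg gt gx.
apply: (Ck_dominatedS (cD _ _ cf cg) (bD _ _ Bf Bg) _ _
  (IH _ _ ft gt) (IH _ _ fx gx)).
- move=> i t x t0; apply: tquotD; apply: tquot_tderive.
    by have [] := df i t x t0.
  by have [] := dg i t x t0.
- move=> i t x t0; rewrite /dx !derive1E; apply: is_deriveD; apply: derivableP.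
    by have [] := df i t x t0.
  by have [] := dg i t x t0.
Qed.

(** By the Leibniz rule each first derivative is a sum of products with one undifferentiated factor;
    that factor is lowered to order r before the induction hypothesis applies. *)
Lemma Ck_dominatedM r e e' f g : Ck_dominated r e f -> Ck_dominated r e' g ->
  Ck_dominated r (e \* e') (fun i t x => f i t x * g i t x).
Proof.
have cM f' g' : (forall i, strip_continuous (f' i)) ->
    (forall i, strip_continuous (g' i)) -> forall i,
    strip_continuous (fun t x => f' i t x * g' i t x).
  by move=> cf cg i z; apply: cvgM; [exact: cf|exact: cg].
have bM f' g' : dominated e f' -> dominated e' g' ->
    dominated (e \* e') (fun i t x => f' i t x * g' i t x).
  move=> [B Bf] [B' Bg]; exists (B * B') => i t x t0T.
  rewrite normrM /=.
  rewrite [leRHS](_ : _ = (B * e x) * (B' * e' x)); last by ring.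
  by rewrite ler_pM// ?Bf ?Bg.
elim: r f g => [|r IH] f g kf kg; have [cf Bf df] := kf; have [cg Bg dg] := kg.
  by split=> //; [exact: cM|exact: bM].
have kf' := Ck_dominatedW (leqnSn r) kf.
have kg' := Ck_dominatedW (leqnSn r) kg.
case: df => df ft fx; case: dg => dg gt gx.
apply: (Ck_dominatedS (cM _ _ cf cg) (bM _ _ Bf Bg) _ _
  (Ck_dominatedD (IH _ _ ft kg') (IH _ _ kf' gt))
  (Ck_dominatedD (IH _ _ fx kg') (IH _ _ kf' gx))).
- move=> i t x t0; apply: tquotM; apply: tquot_tderive.
    by have [] := df i t x t0.
  by have [] := dg i t x t0.
- move=> i t x t0.
  rewrite /dx !derive1E.
  have := @is_deriveM _ _ (f i t) (g i t) x 1 _ _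
    (derivableP (df i t x t0).2) (derivableP (dg i t x t0).2).
  move=> [dfg fgE]; apply: DeriveDef; first exact: dfg.
  by rewrite [LHS]fgE addrC; congr (_ + _); exact: mulrC.
Qed.

Lemma Ck_dominated_cst r (a : R) :
  Ck_dominated r (cst 1) (fun _ _ _ => a).
Proof.
elim: r a => [|r IH] a.
  split=> [i z||//]; first exact: cvg_cst.
  by exists `|a| => *; rewrite mulr1.
apply: (@Ck_dominatedS _ _ _ (fun _ _ _ => 0) (fun _ _ _ => 0)) => //.
- by move=> i z; exact: cvg_cst.
- by exists `|a| => *; rewrite mulr1.
- by move=> i t x t0; exact: tquot_cst.
Qed.

Lemma Ck_dominatedMl r e f g :
  Ck_dominated r (cst 1) f -> Ck_dominated r e g ->
  Ck_dominated r e (fun i t x => f i t x * g i t x).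
Proof.
move=> kf kg; have := Ck_dominatedM kf kg.
by rewrite (_ : cst 1 \* e = e)//; apply/funext => x /=; rewrite mul1r.
Qed.

Lemma Ck_dominatedN r e f : Ck_dominated r e f ->
  Ck_dominated r e (fun i t x => - f i t x).
Proof.
move=> /(Ck_dominatedMl (Ck_dominated_cst r (-1))).
by apply: eq_Ck_dominated => i t x _; rewrite mulN1r.
Qed.

Lemma Ck_dominated_time r : Ck_dominated r (cst 1) (fun _ t _ => t).
Proof.
have cf : I -> strip_continuous (fun t _ => t).
  by move=> _; apply: continuous_subspaceT => z; exact: cvg_fst.
have bf : dominated (cst 1) (fun _ t _ => t).
  by exists T => i t x /andP[t0 tT]; rewrite mulr1 ger0_norm.
case: r => [|r]; first by split.
apply: (@Ck_dominatedS _ _ _ (fun _ _ _ => 1) (fun _ _ _ => 0)) => //.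
- by move=> i t x t0; exact: tquot_id.
- exact: Ck_dominated_cst.
- exact: Ck_dominated_cst.
Qed.

Lemma Ck_derive1 r (g : R -> R) : Ck r.+1 g ->
  [/\ forall x : R, is_derive x (1 : R) g (derive1 g x), continuous g
    & Ck r (derive1 g)].
Proof.
move=> [dg cg]; split.
- move=> x; rewrite derive1E; apply: derivableP.
  exact: (dg 0 x).
- exact: (cg 0).
- split=> [j x jr|j jr].
    by have := dg j.+1 x jr; rewrite /derive1n iterSr.
  by have := cg j.+1 jr; rewrite /derive1n iterSr.
Qed.

(** The composite itself is merely bounded, but each of its derivatives carries a factor [dt u] or
    [dx u] and so inherits the weight [e]. The quantified [r'] names the predecessor of [r], the
    order left after one derivative. *)
Lemma Ck_dominated_comp r e (phi : I -> R -> R) u :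
  (forall x, 0 <= e x <= 1) ->
  (forall i, Ck r (phi i)) ->
  (exists B : R, forall i j (t x : R), (j <= r)%N -> 0 <= t <= T ->
    `|derive1n j (phi i) (u i t x)| <= B) ->
  Ck_dominated r (cst 1) u ->
  (forall r', r = r'.+1 -> Ck_dominated r' e (fun i => dt (u i)) /\
    Ck_dominated r' e (fun i => dx (u i))) ->
  Ck_dominated r (cst 1) (fun i t x => phi i (u i t x)) /\
  (forall r', r = r'.+1 ->
    Ck_dominated r' e (fun i => dt (fun t x => phi i (u i t x))) /\
    Ck_dominated r' e (fun i => dx (fun t x => phi i (u i t x)))).
Proof.
move=> e01; elim: r phi => [|r IH] phi Ckphi [B Bphi] ku kdu.
  split=> //; split=> // [i|].
    have [_ cphi] := Ckphi i.
    exact: strip_continuous_comp (Ck_dominated_cont ku) (cphi 0%N isT).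
  by exists B => i t x t0T; rewrite mulr1; exact: (Bphi i 0).
have dphi i := Ck_derive1 (Ckphi i).
(* The induction hypothesis for the derivative of [phi] controls the outer factor of the chain
   rule. *)
have [||||kphi' _] := IH (fun i => derive1 (phi i)).
- by move=> i; have [_ _] := dphi i.
- exists B => i j t x jr t0T.
  by have := Bphi i j.+1 t x jr t0T; rewrite /derive1n iterSr.
- exact: Ck_dominatedW (leqnSn r) ku.
- move=> r' rE; have [] := kdu r erefl; rewrite rE => ut ux.
  by split; apply: Ck_dominatedW (leqnSn _) _.
have [ut ux] := kdu r erefl.
have kt := Ck_dominatedMl kphi' ut; have kx := Ck_dominatedMl kphi' ux.
have [_ _ [du _ _]] := ku.
have ht i t x : 0 <= t -> tquot (fun s => phi i (u i s x)) t -->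
    derive1 (phi i) (u i t x) * dt (u i) t x.
  move=> t0; apply: (tquot_comp (phi := phi i) (g := (u i)^~ x)).
    by apply: tquot_tderive; have [] := du i t x t0.
  by have [] := dphi i.
have hx i t x : 0 <= t -> is_derive x (1 : R) (fun y => phi i (u i t y))
    (derive1 (phi i) (u i t x) * dx (u i) t x).
  move=> t0; apply: (is_derive1_comp (f := phi i) (g := u i t)).
    by have [] := dphi i.
  by rewrite /dx derive1E; apply: derivableP; have [] := du i t x t0.
have w1 x : 0 <= e x <= cst 1 x by exact: e01.
split.
  apply: (Ck_dominatedS _ _ ht hx (Ck_dominated_weight w1 kt)
    (Ck_dominated_weight w1 kx)).
    move=> i; have [_ cphi _] := dphi i.
    exact: strip_continuous_comp (Ck_dominated_cont ku) cphi.
  by exists B => i t x t0T; rewrite mulr1; exact: (Bphi i 0).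
move=> _ [<-]; split.
  apply: eq_Ck_dominated kt => i t x t0.
  by have [_ <-] := tderiveP t0 (ht i t x t0).
apply: eq_Ck_dominated kx => i t x t0.
by rewrite /dx [RHS]derive1E; have [_ ->] := hx i t x t0.
Qed.

(** The derivative applied first is peeled off: [dx] as long as b > 0, then [dt]. The two never have
    to commute. *)
Lemma dtx_dominated r e f a b : Ck_dominated r e f -> (a + b <= r)%N ->
  dominated e (fun i => dtx a b (f i)).
Proof.
elim: r a b f => [|r IH] a b f.
  by case: a => [|a]; case: b => [|b] // kf _; exact: Ck_dominated_bound kf.
case: b => [|b] kf.
  case: a => [|a] ab; first exact: Ck_dominated_bound kf.
  have [_ _ [_ kt _]] := kf.
  rewrite (_ : (fun i => _) = (fun i => dtx a 0 (dt (f i)))); last first.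
    by apply/funext => i; rewrite /dtx iterSr.
  exact: IH kt ab.
have [_ _ [_ _ kx]] := kf; rewrite addnS ltnS => ab.
rewrite (_ : (fun i => _) = (fun i => dtx a b (dx (f i)))); last first.
  by apply/funext => i; rewrite /dtx iterSr.
exact: IH kx ab.
Qed.

End DominatedFamilies.

(** * The Burgers solution *)

Lemma is_derive_unique (R : realType) (f : R -> R) (x a b : R) :
  is_derive x 1 f a -> is_derive x 1 f b -> a = b.
Proof. by move=> [_ <-] [_ <-]. Qed.

Lemma is_derive_val (R : realType) (f : R -> R) (x a b : R) :
  is_derive x 1 f a -> a = b -> is_derive x 1 f b.
Proof. by move=> + <-. Qed.

Section Burgers.
Context {R : realType} {I : Type}.
Variables (T : R) (m : nat) (E : R -> R).
Variables (w0 : I -> R -> R) (w : I -> R -> R -> R).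

(* The foot at time 0 of the characteristic through (t, x). *)
Definition foot (i : I) (t x : R) : R := x - t * w i t x.

Hypothesis E01 : forall x, 0 <= E x <= 1.
Hypothesis w0_smooth : forall i n, Ck n (w0 i).
Hypothesis w0_mono : forall i x, 0 <= derive1 (w0 i) x.
Hypothesis w0_bounded : exists B : R, forall i x, `|w0 i x| <= B.
Hypothesis w0_decay : exists B : R, forall i j (t x : R), (0 < j <= m.+1)%N ->
  0 <= t <= T -> `|derive1n j (w0 i) (foot i t x)| <= B * E x.
Hypothesis w_burgers : forall i, burgers_solution (w0 i) (w i).

Lemma w0_cont i j : continuous (derive1n j (w0 i)).
Proof. by have [_] := w0_smooth i j; apply. Qed.

Lemma is_derive_w0 i j (x : R) :
  is_derive x (1 : R) (derive1n j (w0 i)) (derive1n j.+1 (w0 i) x).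
Proof.
rewrite /derive1n iterS -/(derive1n j (w0 i)) derive1E; apply: derivableP.
by have [+ _] := w0_smooth i j.+1; apply.
Qed.

(** With |w0| <= B, the map y + t w0(y) is at most x at x - tB and at least x at x + tB; the
    intermediate value theorem gives a foot. *)
Lemma characteristic_surj i t x : 0 <= t -> exists y, y + t * w0 i y = x.
Proof.
move=> t0; have [B Bw] := w0_bounded.
have B0 : 0 <= B by exact: le_trans (normr_ge0 _) (Bw i 0).
have tB0 : 0 <= t * B by rewrite mulr_ge0.
pose F y := y + t * w0 i y.
have cF : {within `[x - t * B, x + t * B], continuous F}.
  apply: continuous_subspaceT => y; apply: cvgD => //.
  by apply: cvgM; [exact: cvg_cst|exact: (@w0_cont i 0)].
have [||c _ Fc] := @IVT R F _ _ x _ cF; last by exists c.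
  by lra.
have Fl : F (x - t * B) <= x.
  rewrite /F -addrA gerDl addrC subr_le0 ler_wpM2l//.
  by rewrite (le_trans (ler_norm _)).
have Fr : x <= F (x + t * B).
  rewrite /F -addrA lerDl -mulrDr mulr_ge0// addrC -lerBlDr sub0r.
  by have := Bw i (x + t * B); rewrite ler_norml => /andP[].
by rewrite (min_idPl (le_trans Fl Fr)) (max_idPr (le_trans Fl Fr)) Fl.
Qed.

(** Every point lies on a characteristic, [w] is constant along it, and subtracting t w from x
    recovers its starting point. *)
Lemma w_foot i t x : 0 <= t -> w i t x = w0 i (foot i t x).
Proof.
move=> t0; have [y <-] := characteristic_surj i x t0.
by have [_ _ _ wE] := w_burgers i; rewrite /foot wE// addrK.
Qed.

Lemma w_diff i t x : 0 <= t ->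
  tquot ((w i)^~ x) t --> - (w i t x * dx (w i) t x) /\
  is_derive x (1 : R) (w i t) (dx (w i) t x).
Proof.
move=> t0; have [/(_ 1%N) [_ [dw _ _]] eqw _ _] := w_burgers i.
have [dwt dwx] := dw t x t0; split.
  have := eqw t x t0 => /eqP; rewrite addr_eq0 => /eqP <-.
  exact: tquot_tderive.
by rewrite /dx derive1E; exact: derivableP.
Qed.

Lemma w_cont i : strip_continuous (w i).
Proof. by have [/(_ 0%N) []] := w_burgers i. Qed.

(* The functions t, w0_jet j and foot_slope = dx foot generate an algebra that
   is stable under dt and dx. *)
Definition w0_jet j i t x := derive1n j (w0 i) (foot i t x).
Definition foot_slope i t x := (1 + t * w0_jet 1 i t x)^-1.

Lemma foot_slope_den i t x : 0 <= t -> 1 <= 1 + t * w0_jet 1 i t x.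
Proof. by move=> t0; rewrite lerDl mulr_ge0//; exact: w0_mono. Qed.

Lemma foot_diff0 i t x : 0 <= t ->
  tquot ((foot i)^~ x) t --> - w i t x * (1 - t * dx (w i) t x) /\
  is_derive x (1 : R) (foot i t) (1 - t * dx (w i) t x).
Proof.
move=> t0; have [wt wx] := w_diff i x t0; split.
  have := tquotD (tquot_cst x t)
    (tquotM (tquot_cst (-1) t) (tquotM (tquot_id t) wt)).
  move=> H; apply: (eq_tquot t0 _ (tquot_eq H _)).
    by move=> s _ /=; rewrite /foot; ring.
  by rewrite /=; ring.
have /= [d1 d2] := is_deriveB (is_derive_id x 1) (is_deriveZ t wx).
by apply: DeriveDef; [exact: d1|exact: d2].
Qed.

(** Differentiating the implicit relation w = w0(foot) gives w_x = w0'(foot) (1 - t w_x). This is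
    solved for w_x, the denominator 1 + t w0'(foot) being at least 1 by monotonicity. *)
Lemma dx_w i t x : 0 <= t ->
  dx (w i) t x = w0_jet 1 i t x * foot_slope i t x /\
  1 - t * dx (w i) t x = foot_slope i t x.
Proof.
move=> t0; have [_ fx] := foot_diff0 i x t0.
have [_ wx] := w_diff i x t0.
have wf : w i t = derive1n 0 (w0 i) \o foot i t.
  by apply/funext => y /=; rewrite w_foot.
have wx' := is_derive1_comp (is_derive_w0 i 0 (foot i t x)) fx.
rewrite -wf in wx'.
have := is_derive_unique wx wx'; rewrite -/(w0_jet 1 i t x) /foot_slope => dE.
have d1 := foot_slope_den i x t0.
have d0 : 1 + t * w0_jet 1 i t x != 0 by rewrite gt_eqF// (lt_le_trans ltr01).
have dE' : dx (w i) t x = w0_jet 1 i t x * (1 + t * w0_jet 1 i t x)^-1.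
  apply: (mulIf d0); rewrite mulfVK// mulrDr mulr1 {1}dE; ring.
by split=> //; rewrite dE'; field.
Qed.

Lemma foot_diff i t x : 0 <= t ->
  tquot ((foot i)^~ x) t --> - w i t x * foot_slope i t x /\
  is_derive x (1 : R) (foot i t) (foot_slope i t x).
Proof.
by move=> t0; have := foot_diff0 i x t0; rewrite (dx_w i x t0).2.
Qed.

Lemma w0_jet_diff j i t x : 0 <= t ->
  tquot ((w0_jet j i)^~ x) t -->
    - (w i t x * (foot_slope i t x * w0_jet j.+1 i t x)) /\
  is_derive x (1 : R) (w0_jet j i t) (foot_slope i t x * w0_jet j.+1 i t x).
Proof.
move=> t0; have [ft fx] := foot_diff i x t0; split.
  apply: tquot_eq (tquot_comp ft (is_derive_w0 i j _)) _.
  by rewrite /w0_jet; ring.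
by rewrite mulrC; exact: is_derive1_comp (is_derive_w0 i j _) fx.
Qed.

Lemma foot_slope_diff i t x : 0 <= t ->
  tquot ((foot_slope i)^~ x) t --> - (foot_slope i t x * (foot_slope i t x *
     (w0_jet 1 i t x +
      t * - (w i t x * (foot_slope i t x * w0_jet 2 i t x))))) /\
  is_derive x (1 : R) (foot_slope i t)
     (- (foot_slope i t x * (foot_slope i t x *
        (t * (foot_slope i t x * w0_jet 2 i t x))))).
Proof.
move=> t0; have [Wt Wx] := w0_jet_diff 1 i x t0.
have d1 := foot_slope_den i x t0.
have d0 : 1 + t * w0_jet 1 i t x != 0 by rewrite gt_eqF// (lt_le_trans ltr01).
have dV : is_derive (1 + t * w0_jet 1 i t x) 1 (fun y : R => y^-1)
    (- (foot_slope i t x * foot_slope i t x)).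
  have := @is_deriveV R id (1 + t * w0_jet 1 i t x) 1 1 d0 (is_derive_id _ _).
  move=> /is_derive_val; apply.
  by rewrite [LHS]mulr1 /foot_slope expr2 invfM.
split.
  apply: tquot_eq (tquot_comp (tquotD (tquot_cst 1 t)
    (tquotM (tquot_id t) Wt)) dV) _.
  by rewrite /=; ring.
have := is_derive1_comp (g := cst 1 + t \*: w0_jet 1 i t) dV
   (is_deriveD (is_derive_cst (1 : R) x (1 : R)) (is_deriveZ t Wx)).
move=> /is_derive_val; apply.
by rewrite add0r [t *: _]/(t * _) !mulNr !mulrA.
Qed.

Lemma foot_cont i : strip_continuous (foot i).
Proof.
move=> z; apply: cvgB.
  apply: (@continuous_subspaceT _ _ _ (snd : R * R -> R)) => u.
  exact: cvg_snd.
apply: cvgM; last exact: w_cont.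
apply: (@continuous_subspaceT _ _ _ (fst : R * R -> R)) => u.
exact: cvg_fst.
Qed.

Lemma w0_jet_cont j i : strip_continuous (w0_jet j i).
Proof. exact: strip_continuous_comp (@foot_cont i) (@w0_cont i j). Qed.

(** Continuity is taken from w_x through the identity [foot_slope] = 1 - t w_x. *)
Lemma foot_slope_cont i : strip_continuous (foot_slope i).
Proof.
apply: (@eq_strip_continuous _ (fun t x => 1 - t * dx (w i) t x)).
  by move=> t x t0; rewrite (dx_w i x t0).2.
have [/(_ 1%N) [_ [_ _ [dwc _]]] _ _ _] := w_burgers i.
move=> z; apply: cvgB; first exact: cvg_cst.
apply: cvgM; last exact: dwc.
apply: (@continuous_subspaceT _ _ _ (fst : R * R -> R)) => u.
exact: cvg_fst.
Qed.

(** The three families are treated in one induction because their derivatives involve each other. A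
    derivative of [w0_jet j] costs one jet order, whence j + r <= m + 1. A derivative of
    [foot_slope] contains [w0_jet 2], whence its order stops at m. Only the jets decay; [w] and
    [foot_slope] are merely bounded. *)
Lemma burgers_dominated_aux r :
  [/\ forall j, (0 < j)%N -> (j + r <= m.+1)%N -> Ck_dominated T r E (w0_jet j),
     (r <= m.+1)%N -> Ck_dominated T r (cst 1) w &
     (r <= m)%N -> Ck_dominated T r (cst 1) foot_slope].
Proof.
have Jb : dominated T (cst 1) foot_slope.
  exists 1 => i t x /andP[t0 _]; rewrite mulr1 /foot_slope.
  have d1 := foot_slope_den i x t0.
  by rewrite ger0_norm ?invr_ge0 ?invf_le1// ?(lt_le_trans ltr01)//
    (le_trans ler01).
have wb : dominated T (cst 1) w.
  have [B Bw] := w0_bounded; exists B => i t x /andP[t0 _].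
  by rewrite mulr1 w_foot.
have Wb j : (0 < j <= m.+1)%N -> dominated T E (w0_jet j).
  move=> jm; have [B BW] := w0_decay; exists B => i t x t0T.
  exact: BW.
have w1 x : 0 <= E x <= cst 1 x by exact: E01.
elim: r => [|r [IHW IHw IHJ]].
  split=> [j j0 jm|_|_].
  - split=> //; first by move=> i; exact: w0_jet_cont.
    by apply: Wb; rewrite j0 -(addn0 j).
  - by split=> //; exact: w_cont.
  - by split=> //; exact: foot_slope_cont.
split=> [j j0 jm|rm|rm].
- have kW := IHW j.+1 isT; rewrite addSnnS in kW; have {}kW := kW jm.
  have rm : (r <= m)%N by rewrite -ltnS (leq_trans _ jm)// addnS ltnS leq_addl.
  have kJ := Ck_dominatedMl (IHJ rm) kW.
  have kw := Ck_dominatedN (Ck_dominatedMl (IHw (leqW rm)) kJ).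
  apply: (Ck_dominatedS _ _ _ _ kw kJ).
  + by move=> i; exact: w0_jet_cont.
  + by apply: Wb; rewrite j0 (leq_trans _ jm)// leq_addr.
  + by move=> i t x t0; have [] := w0_jet_diff j i x t0.
  + by move=> i t x t0; have [] := w0_jet_diff j i x t0.
- have kW := IHW 1%N isT rm; rewrite ltnS in rm.
  have kJ := Ck_dominated_weight w1 (Ck_dominatedMl (IHJ rm) kW).
  have kw := Ck_dominatedN (Ck_dominatedMl (IHw (leqW rm)) kJ).
  apply: (Ck_dominatedS _ _ _ _ kw kJ).
  + by move=> i; exact: w_cont.
  + exact: wb.
  + move=> i t x t0; have [+ _] := w_diff i x t0.
    by rewrite (dx_w i x t0).1 [w0_jet 1 i t x * _]mulrC.
  + move=> i t x t0; have [_] := w_diff i x t0.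
    by rewrite (dx_w i x t0).1 [w0_jet 1 i t x * _]mulrC.
- have kW1 := Ck_dominated_weight w1 (IHW 1%N isT (leqW rm)).
  have kW2 := Ck_dominated_weight w1 (IHW 2%N isT rm).
  have rm' := ltnW rm; have kJ := IHJ rm'; have kw := IHw (leqW rm').
  have kt := Ck_dominated_time T r (I := I).
  have kJW := Ck_dominatedMl kJ kW2.
  apply: (Ck_dominatedS _ _ _ _
    (Ck_dominatedN (Ck_dominatedMl kJ (Ck_dominatedMl kJ (Ck_dominatedD kW1
      (Ck_dominatedMl kt (Ck_dominatedN (Ck_dominatedMl kw kJW)))))))
    (Ck_dominatedN (Ck_dominatedMl kJ (Ck_dominatedMl kJ
      (Ck_dominatedMl kt kJW))))).
  + by move=> i; exact: foot_slope_cont.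
  + exact: Jb.
  + by move=> i t x t0; have [] := foot_slope_diff i x t0.
  + by move=> i t x t0; have [] := foot_slope_diff i x t0.
Qed.

(** Both first derivatives of [w] contain the factor [w0_jet 1], which decays and is controlled up
    to order m. *)
Lemma burgers_dominated :
  [/\ Ck_dominated T m.+1 (cst 1) w,
      Ck_dominated T m E (fun i => dt (w i)) &
      Ck_dominated T m E (fun i => dx (w i))].
Proof.
have [_ /(_ (leqnn _)) kw _] := burgers_dominated_aux m.+1.
have [/(_ 1%N isT (leqnn _)) kW _ /(_ (leqnn _)) kJ] := burgers_dominated_aux m.
split=> //.
  have := Ck_dominatedN (Ck_dominatedMl (Ck_dominatedW (leqnSn _) kw)
    (Ck_dominatedMl kJ kW)).
  apply: eq_Ck_dominated => i t x t0; have [wt _] := w_diff i x t0.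
  by rewrite /dt (tderiveP t0 wt).2 (dx_w i x t0).1 [w0_jet 1 i t x * _]mulrC.
have := Ck_dominatedMl kJ kW; apply: eq_Ck_dominated => i t x t0.
by rewrite (dx_w i x t0).1 mulrC.
Qed.

End Burgers.

(** * Uniform bounds for coordinates on rarefaction arcs *)

Section Derive1n.
Context {R : realType}.
Implicit Types (f g : R -> R) (c y : R).

Lemma near_eq_derive1n j f g y : (\forall x \near y, f x = g x) ->
  \forall x \near y, derive1n j f x = derive1n j g x.
Proof.
move=> fg; elim: j => [//|j IH].
have := near_join IH; apply: filterS => x fgx.
by rewrite /= !derive1E; exact: near_eq_derive.
Qed.

Lemma derive1n_shift j f c :
  derive1n j (fun x => f (x - c)) = (fun x => derive1n j f (x - c)).
Proof.
elim: j => [//|j IH]; rewrite /= -/(derive1n j _) IH.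
apply/funext => x; rewrite /derive1 -/(derive1n j f).
by under eq_fun do rewrite -addrA.
Qed.

Lemma derive1nS_addC j f c :
  derive1n j.+1 (fun x => f x + c) = derive1n j.+1 f.
Proof.
rewrite /derive1n !iterSr; congr (iter _ _ _).
apply/funext => x; rewrite /derive1.
by under eq_fun do rewrite opprD addrACA subrr addr0.
Qed.

(** One-sided limits carry the bound to the endpoints. This is needed because coordinates of
    different arcs are compared only at interior points. *)
Lemma le_itv_closure f (a b B : R) : a < b -> continuous f ->
  (forall y, a < y < b -> `|f y| <= B) ->
  forall y, a <= y <= b -> `|f y| <= B.
Proof.
move=> ab cf fB y /andP[]; rewrite le_eqVlt => /predU1P[<- _|ay].
  apply: (@closed_cvg _ _ (a^'+) _ f (fun v => `|v| <= B) _ _ (f a)).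
  - exact: (closed_comp (fun _ _ => @norm_continuous _ _ _) (@closed_le _ B)).
  - near=> x; apply: fB; apply/andP; split.
      by near: x; exact: nbhs_right_gt.
    by near: x; exact: nbhs_right_lt.
  - exact: cvg_at_right_filter (cf a).
rewrite le_eqVlt => /predU1P[->|yb]; last by apply: fB; rewrite ay.
apply: (@closed_cvg _ _ (b^'-) _ f (fun v => `|v| <= B) _ _ (f b)).
- exact: (closed_comp (fun _ _ => @norm_continuous _ _ _) (@closed_le _ B)).
- near=> x; apply: fB; apply/andP; split; last by near: x; exact: nbhs_left_lt.
  by near: x; exact: nbhs_left_gt.
- exact: cvg_at_left_filter (cf b).
Unshelve. all: by end_near. Qed.

Lemma Ck_itv_bounded r f (a b : R) : a <= b -> Ck r f ->
  exists B : R, forall j y, (j <= r)%N -> a <= y <= b -> `|derive1n j f y| <= B.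
Proof.
move=> ab [_ cf].
have bj j : (j <= r)%N ->
    exists B : R, forall y, a <= y <= b -> `|derive1n j f y| <= B.
  move=> jr; pose F x := `|derive1n j f x|.
  have cF : {within `[a, b], continuous F}.
    apply: continuous_subspaceT => x.
    exact: cvg_norm (cf j jr x).
  have [c _ Fc] := EVT_max ab cF.
  by exists (F c) => y yab; apply: Fc; rewrite in_itv.
elim: r bj {cf} => [|r IH] bj.
  have [B HB] := bj 0 isT; exists B => j y; rewrite leqn0 => /eqP ->; exact: HB.
have [B HB] := IH (fun j jr => bj j (leqW jr)).
have [B' HB'] := bj r.+1 (leqnn _).
exists (Num.max B B') => j y; rewrite leq_eqVlt => /predU1P[->|jr] yab.
  by rewrite le_max HB' ?orbT.
by rewrite le_max HB.
Qed.

End Derive1n.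

(** * Coordinates of arcs with overlapping densities *)

Section RarefactionRegime.
Context {R : realType}.
Variables (p : R -> R) (nlo nhi : R) (k : bool) (r : nat).
Implicit Types (e : (R * R) * (R * R)) (z : R * R) (G : R -> R).

Local Notation lam := (lambda p k).
Local Notation curve e := (rarefaction_curve p nlo k e.1 e.2).
Local Notation regime := (rarefaction_regime r p nlo nhi k).

Definition lo e := Num.min e.1.1 e.2.1.
Definition hi e := Num.max e.1.1 e.2.1.

(** [smooth_coordinate] with the inverse replaced by its C^r extension to the whole line, so that
    [derive1n] makes sense up to the endpoints. *)
Definition coordinate e G1 G2 : Prop :=
  [/\ Ck r G1, Ck r G2,
      forall y, lam e.1 <= y <= lam e.2 ->
        curve e (G1 y, G2 y) /\ lam (G1 y, G2 y) = y
    & forall z, curve e z ->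
        lam e.1 <= lam z <= lam e.2 /\ z = (G1 (lam z), G2 (lam z))].

Lemma regime_coordinate e : regime e -> exists G1 G2, coordinate e G1 G2.
Proof.
case: e => zm zp [_ _ _ [g1 [g2 [[G1 C1 E1] [G2 C2 E2] gc cg]]] _].
exists G1, G2; split=> // [y yI|z /cg [zI zE]]; last first.
  by split; [rewrite in_itv in zI|rewrite -E1 -?E2].
by rewrite -E1 -?E2 ?in_itv//; apply: gc; rewrite in_itv.
Qed.

Lemma curve_left e : curve e e.1.
Proof. by split=> //; rewrite in_itv /= ge_min lexx le_max lexx. Qed.

Lemma regime_curve_right e : regime e -> curve e e.2.
Proof. by case: e => zm zp []. Qed.

Lemma regime_lambda e : regime e -> lam e.1 < lam e.2.
Proof. by case: e => zm zp []. Qed.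

(** The Riemann invariant is V plus a function of N, so on its level set the density determines the
    velocity. *)
Lemma curve_inj e z z' : curve e z -> curve e z' -> z.1 = z'.1 -> z = z'.
Proof.
move=> [_ Rz] [_ Rz'] zz'; rewrite [z]surjective_pairing [z']surjective_pairing.
rewrite -zz'; congr pair.
by have := etrans Rz (esym Rz'); rewrite /riemann -zz' => /addIr.
Qed.

Lemma regime_density e z : regime e -> curve e z -> nlo < z.1 < nhi.
Proof.
case: e => zm zp [[/andP[m1 m2] /andP[p1 p2]] _ _ _ _] [] /=.
rewrite in_itv /= => /andP[l h] _.
rewrite (lt_le_trans _ l) ?lt_min ?m1//=.
by rewrite (le_lt_trans h)// gt_max m2.
Qed.

Lemma regime_neq e : regime e -> e.1.1 != e.2.1.
Proof.
move=> re; apply/eqP => /(curve_inj (curve_left e) (regime_curve_right re)) E.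
by have := regime_lambda re; rewrite E ltxx.
Qed.

Lemma regime_lo_hi e : regime e -> lo e < hi e.
Proof.
move=> /regime_neq; rewrite /lo /hi neq_lt => /orP[] h.
  by rewrite (min_idPl (ltW h)) (max_idPr (ltW h)).
by rewrite (min_idPr (ltW h)) (max_idPl (ltW h)).
Qed.

(** A state of the arc with an end density is that end state by [curve_inj], so its lambda_k is an
    end value and not an interior one. *)
Lemma coordinate_interior e G1 G2 y : regime e -> coordinate e G1 G2 ->
  lam e.1 < y < lam e.2 -> lo e < G1 y < hi e.
Proof.
move=> re [_ _ Gc _] /andP[ly yl].
have [cz lz] : curve e (G1 y, G2 y) /\ lam (G1 y, G2 y) = y.
  by apply: Gc; rewrite !ltW.
have n1 : G1 y != e.1.1.
  apply/eqP => /(curve_inj (z := (G1 y, G2 y)) cz (curve_left e)) E.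
  by move: ly; rewrite -{1}lz E ltxx.
have n2 : G1 y != e.2.1.
  apply/eqP => /(curve_inj (z := (G1 y, G2 y)) cz (regime_curve_right re)) E.
  by move: yl; rewrite -{1}lz E ltxx.
have [/= + _] := cz; rewrite in_itv /= /lo /hi ge_min le_max gt_min lt_max.
rewrite !le_eqVlt (negbTE n1) (negbTE n2) !(eq_sym _ (G1 y)).
by rewrite (negbTE n1) (negbTE n2).
Qed.

(* Over common densities, two arcs of the k-family differ by a translation of
   the velocity, hence of lambda_k: their coordinates have equal derivatives. *)
Lemma coordinate_overlap e e' G1 G2 G1' G2' y :
  coordinate e G1 G2 -> coordinate e' G1' G2' ->
  lam e'.1 < y < lam e'.2 -> lo e < G1' y < hi e ->
  exists c, lam e.1 <= y - c <= lam e.2 /\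
   \forall x \near y, G1' x = G1 (x - c) /\ G2' x = G2 (x - c) + c.
Proof.
move=> [_ _ _ Gcurve] [[_ cG1'] _ Gc' _] /andP[ly yl] /andP[lG Gh].
(* Lowering the velocity by the difference of the two Riemann constants moves a state of the arc of
   [e'] onto the level set of [e], and lowers lambda_k by the same amount. *)
pose c := riemann p nlo (~~ k) e'.1 - riemann p nlo (~~ k) e.1.
have key x : lam e'.1 <= x <= lam e'.2 -> lo e < G1' x < hi e ->
    lam e.1 <= x - c <= lam e.2 /\ G1' x = G1 (x - c) /\ G2' x = G2 (x - c) + c.
  move=> xI /andP[l h]; have [[/= _ Rz] lz] := Gc' x xI.
  have cz : curve e (G1' x, G2' x - c).
    split; first by rewrite in_itv /= !ltW.
    by move: Rz; rewrite /riemann/= addrAC => ->; rewrite /c subKr.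
  have lE : lam (G1' x, G2' x - c) = x - c.
    by rewrite -[in RHS]lz /lambda /= addrAC.
  have [] := Gcurve _ cz; rewrite lE => xc [-> E2].
  by split=> //; split=> //; rewrite -E2 subrK.
exists c; split; first by apply: (key y _ _).1; rewrite ?lG ?ltW.
(* The strict inequalities at y persist nearby, so the identity holds on a neighbourhood and can be
   differentiated. *)
have cG : {for y, continuous G1'} by exact: (cG1' 0 isT).
near=> x; apply: (key x _ _).2.
  by apply/andP; split; apply: ltW; near: x; [exact: lt_nbhsr|exact: lt_nbhsl].
apply/andP; split; near: x.
  exact: (cG _ (lt_nbhsr lG)).
exact: (cG _ (lt_nbhsl Gh)).
Unshelve. all: by end_near. Qed.

(* G2 itself is excluded: on overlapping arcs the second coordinates differ by a
   constant. *)
Definition derive_bound G1 G2 (B y : R) : Prop := forall j, (j <= r)%N ->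
  `|derive1n j G1 y| <= B /\ ((0 < j)%N -> `|derive1n j G2 y| <= B).

(** One arc bounds all others over its densities: its own coordinate has bounded derivatives on a
    compact interval, and [coordinate_overlap] transfers them. The additive constant in the second
    coordinate disappears after one derivative. *)
Lemma coordinate_cover e : regime e -> exists B : R, forall e' G1' G2' y,
  coordinate e' G1' G2' ->
  lam e'.1 < y < lam e'.2 -> lo e < G1' y < hi e -> derive_bound G1' G2' B y.
Proof.
move=> re; have [G1 [G2 cG]] := regime_coordinate re.
have [C1 C2 _ _] := cG; have lam_le := ltW (regime_lambda re).
have [B1 H1] := Ck_itv_bounded lam_le C1.
have [B2 H2] := Ck_itv_bounded lam_le C2.
exists (Num.max B1 B2) => e' G1' G2' y cG' yI Gy j jr.
have [c [ycI GE]] := coordinate_overlap cG cG' yI Gy.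
have E1 : derive1n j G1' y = derive1n j G1 (y - c).
  rewrite -[RHS]/((fun x => derive1n j G1 (x - c)) y) -derive1n_shift.
  have G1E : \forall x \near y, G1' x = G1 (x - c).
    by apply: filterS GE => x [].
  by have /nbhs_singleton := near_eq_derive1n j G1E.
split; first by rewrite E1 le_max H1.
case: j jr {E1} => // j jr _.
have -> : derive1n j.+1 G2' y = derive1n j.+1 G2 (y - c).
  rewrite -[RHS]/((fun x => derive1n j.+1 G2 (x - c)) y) -derive1n_shift.
  rewrite -(derive1nS_addC j (fun x => G2 (x - c)) c).
  have G2E : \forall x \near y, G2' x = G2 (x - c) + c.
    by apply: filterS GE => x [].
  by have /nbhs_singleton := near_eq_derive1n j.+1 G2E.
by rewrite le_max H2// orbT.
Qed.

Definition bounded_coordinate (B : R) e : Prop := exists G1 G2,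
  coordinate e G1 G2 /\
  forall y, lam e.1 <= y <= lam e.2 -> derive_bound G1 G2 B y.

Lemma left_density_cont : continuous (fun e : (R * R) * (R * R) => e.1.1).
Proof. by move=> e; apply: (cvg_comp _ _ cvg_fst cvg_fst). Qed.

Lemma right_density_cont : continuous (fun e : (R * R) * (R * R) => e.2.1).
Proof. by move=> e; apply: (cvg_comp _ _ cvg_snd cvg_fst). Qed.

Lemma lo_cont : continuous lo.
Proof.
move=> e; exact: (@continuous_min _ _ (fun e : (R * R) * (R * R) => e.1.1)
  (fun e => e.2.1) e (@left_density_cont e) (@right_density_cont e)).
Qed.

Lemma hi_cont : continuous hi.
Proof.
move=> e; exact: (@continuous_max _ _ (fun e : (R * R) * (R * R) => e.1.1)
  (fun e => e.2.1) e (@left_density_cont e) (@right_density_cont e)).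
Qed.

(* Arcs close to the arc of e may stick out of it at either end.  If some arc
   starting strictly before e covers the left end of e, it takes care of the
   excess there; if there is none, nearby arcs do not stick out on the left. *)
Lemma regime_near_bounded (K : set ((R * R) * (R * R))) e :
  K `<=` regime -> K e ->
  exists B : R, \forall e' \near e, K e' -> bounded_coordinate B e'.
Proof.
move=> Kr Ke; have re := Kr _ Ke; have lh := regime_lo_hi re.
have [B0 HB0] := coordinate_cover re.
have [B1 HB1] : exists B : R, \forall e' \near e, K e' ->
    forall G1 G2 y, coordinate e' G1 G2 -> lam e'.1 < y < lam e'.2 ->
    G1 y <= lo e -> derive_bound G1 G2 B y.
  have [[e1 [Ke1 l1 h1]]|no] :=
      pselect (exists e1, [/\ K e1, lo e1 < lo e & lo e < hi e1]).
    have [B HB] := coordinate_cover (Kr _ Ke1); exists B.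
    near=> e' => Ke' G1 G2 y cG yI Gy; apply: (HB e') => //.
    have /andP[lG _] := coordinate_interior (Kr _ Ke') cG yI.
    rewrite (le_lt_trans Gy h1) andbT (lt_trans _ lG)//.
    near: e'; exact: (@lo_cont e _ (lt_nbhsr l1)).
  (* The value of the bound is immaterial: a nearby arc reaching a density at or below [lo e] would
     itself be an arc of the excluded kind. *)
  exists 0; near=> e' => Ke' G1 G2 y cG yI Gy.
  have /andP[lG _] := coordinate_interior (Kr _ Ke') cG yI.
  exfalso; apply: no; exists e'; split=> //; first exact: lt_le_trans Gy.
  near: e'; exact: (@hi_cont e _ (lt_nbhsr lh)).
have [B2 HB2] : exists B : R, \forall e' \near e, K e' ->
    forall G1 G2 y, coordinate e' G1 G2 -> lam e'.1 < y < lam e'.2 ->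
    hi e <= G1 y -> derive_bound G1 G2 B y.
  have [[e1 [Ke1 l1 h1]]|no] :=
      pselect (exists e1, [/\ K e1, lo e1 < hi e & hi e < hi e1]).
    have [B HB] := coordinate_cover (Kr _ Ke1); exists B.
    near=> e' => Ke' G1 G2 y cG yI Gy; apply: (HB e') => //.
    have /andP[_ Gh] := coordinate_interior (Kr _ Ke') cG yI.
    rewrite (lt_le_trans l1 Gy) (lt_trans Gh)//.
    near: e'; exact: (@hi_cont e _ (lt_nbhsl h1)).
  exists 0; near=> e' => Ke' G1 G2 y cG yI Gy.
  have /andP[_ Gh] := coordinate_interior (Kr _ Ke') cG yI.
  exfalso; apply: no; exists e'; split=> //; last exact: le_lt_trans Gh.
  near: e'; exact: (@lo_cont e _ (lt_nbhsl lh)).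
exists (Num.max B0 (Num.max B1 B2)).
move: HB1 HB2; apply: filterS2 => e' H1 H2 Ke'; have re' := Kr _ Ke'.
have [G1 [G2 cG]] := regime_coordinate re'.
have [[dG1 cG1] [dG2 cG2] _ _] := cG.
exists G1, G2; split=> //.
(* Interior points are sorted by their density: at or below [lo e], at or above [hi e], or strictly
   between, each case having its own bound. *)
have oo y : lam e'.1 < y < lam e'.2 ->
    derive_bound G1 G2 (Num.max B0 (Num.max B1 B2)) y.
  move=> yI j jr; rewrite !le_max.
  have [Gl|lG] := leP (G1 y) (lo e).
    have [-> H] := H1 Ke' G1 G2 y cG yI Gl j jr.
    by split; rewrite ?orbT// => /H ->; rewrite ?orbT.
  have [hG|Gh] := leP (hi e) (G1 y).
    have [-> H] := H2 Ke' G1 G2 y cG yI hG j jr.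
    by split; rewrite ?orbT// => /H ->; rewrite ?orbT.
  have Gy : lo e < G1 y < hi e by rewrite lG.
  have [-> H] := HB0 e' G1 G2 y cG yI Gy j jr.
  by split=> // /H ->.
move=> y yI j jr; have lam_lt := regime_lambda re'; split.
  apply: (le_itv_closure lam_lt (cG1 j jr) _ yI) => x xI.
  by have [] := oo x xI j jr.
move=> j0; apply: (le_itv_closure lam_lt (cG2 j jr) _ yI) => x xI.
by have [_] := oo x xI j jr; apply.
Unshelve. all: by end_near. Qed.

Lemma bounded_coordinateW B B' e : B <= B' ->
  bounded_coordinate B e -> bounded_coordinate B' e.
Proof.
move=> BB [G1 [G2 [cG HB]]]; exists G1, G2; split=> // y yI j jr.
have [H1 H2] := HB y yI j jr; split; first exact: le_trans BB.
by move=> /H2 /le_trans; apply.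
Qed.

(** Compactness is used as the near-covering property with the bound tending to +oo, in place of a
    maximum over a finite subcover. Monotonicity in the bound makes every sufficiently large value
    admissible locally. *)
Lemma compact_near_bounded (K : set ((R * R) * (R * R)))
    (P : R -> (R * R) * (R * R) -> Prop) :
  compact K -> (forall B B' e, B <= B' -> P B e -> P B' e) ->
  (forall e, K e -> exists B : R, \forall e' \near e, K e' -> P B e') ->
  exists B : R, forall e, K e -> P B e.
Proof.
move=> /compact_near_coveringP cK Pmono Ploc.
have := cK R (+oo) (fun B e => K e -> P B e) _.
move=> /(_ _)[e Ke|]; last first.
  move=> M [_ HM]; exists (M + 1) => e Ke; apply: (HM (M + 1)) => //.
  by rewrite ltrDl.
have [B HB] := Ploc e Ke.
exists ([set e' | K e' -> P B e'], [set B' | B <= B']).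
  by split=> //=; exact: (nbhs_pinfty_ge (num_real B)).
by move=> [e' B'] [/= He' BB'] Ke'; apply: Pmono (He' Ke').
Qed.

End RarefactionRegime.

(** * The effective Euler system *)

Lemma near_eq_continuous (R : realType) (f g : R -> R) (x : R) :
  (\forall y \near x, f y = g y) ->
  {for x, continuous g} -> {for x, continuous f}.
Proof.
move=> fg cg; have fx : f x = g x by exact: (nbhs_singleton fg).
suff : f y @[y --> x] --> f x by [].
rewrite fx; apply: cvg_trans cg; apply: near_eq_cvg.
by apply: filterS fg => y ->.
Qed.

Section Pressure.
Context {R : realType}.
Variables (r : nat) (nlo nhi plo : R) (p : R -> R).
Hypothesis hp : pressure_assumption r.+1 nlo nhi plo p.

Lemma density_interior n : nlo <= n <= nhi -> n \in `]nlo / 4, 2 * nhi[.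
Proof.
case: hp => n0 nn _ _ _ /andP[ln nh]; rewrite in_itv /=; apply/andP; split; lra.
Qed.

(** [p] agrees with a C^r function only on the closed interval, but at an interior point this
    determines the derivative near that point. *)
Lemma dpressure_cont n : n \in `]nlo / 4, 2 * nhi[ ->
  {for n, continuous (derive1 p)}.
Proof.
case: hp => _ _ _ [g [_ cg] pg] _ nI.
have pg' y : y \in `]nlo / 4, 2 * nhi[ -> derive1 p y = derive1 g y.
  move=> yI; rewrite !derive1E; apply: near_eq_derive.
  have := near_in_itvoo yI; apply: filterS => z zI; apply: pg.
  exact: subset_itv_oo_cc zI.
apply: near_eq_continuous (cg 1%N isT n).
by have := near_in_itvoo nI; apply: filterS => z zI; exact: pg' z zI.
Qed.

Lemma cq_cont n : n \in `]nlo / 4, 2 * nhi[ -> {for n, continuous (cq p)}.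
Proof.
move=> nI; rewrite /cq.
apply: (@continuous_comp _ _ _ (fun n => derive1 p n + 1) Num.sqrt).
  by apply: cvgD; [exact: dpressure_cont|exact: cvg_cst].
exact: sqrt_continuous.
Qed.

Lemma cq_sqr n : n \in `]nlo / 4, 2 * nhi[ -> cq p n ^+ 2 = derive1 p n + 1.
Proof.
case: hp => _ _ plo0 _ pp nI; rewrite sqr_sqrtr// addr_ge0//.
exact: le_trans (ltW plo0) (pp _ nI).
Qed.

Lemma norm_sgn k : `|sgn k| = 1 :> R.
Proof. by case: k; rewrite /sgn ?normrN normr1. Qed.

Lemma cq_bounded : exists B : R, forall n, nlo <= n <= nhi -> `|cq p n| <= B.
Proof.
case: hp => _ nn _ _ _.
have [c _ Hc] : exists2 c, c \in `[nlo, nhi] &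
    forall n, n \in `[nlo, nhi] -> cq p n <= cq p c.
  apply: EVT_max; first exact: ltW.
  apply: continuous_in_subspaceT => n; rewrite inE /= in_itv /= => nI.
  by apply: cq_cont; exact: density_interior.
exists (cq p c) => n nI; rewrite ger0_norm ?sqrtr_ge0//.
by apply: Hc; rewrite in_itv.
Qed.

Definition sound_primitive (n : R) : R :=
  \int[lebesgue_measure]_(y in `[nlo, n]) (cq p y / y).

Lemma is_derive_sound_primitive n : nlo < n < nhi ->
  is_derive n (1 : R) sound_primitive (cq p n / n).
Proof.
move=> /andP[ln nh]; have [n0 _ _ _ _] := hp.
have cF y : nlo <= y <= nhi -> {for y, continuous (fun y => cq p y / y)}.
  move=> yI; apply: cvgM; first by apply: cq_cont; exact: density_interior.
  apply: cvgV; last exact: cvg_id.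
  by rewrite gt_eqF//; case/andP: yI => yl _; exact: lt_le_trans yl.
have [||d1 d2] :=
  @continuous_FTC1_closed R (fun y => cq p y / y) nlo n nhi nh _ ln.
- apply: continuous_compact_integrable; first exact: segment_compact.
  apply: continuous_in_subspaceT => y; rewrite inE /= in_itv /= => yI.
  exact: cF.
- by apply: cF; rewrite !ltW.
by apply: DeriveDef; [exact: d1|rewrite -d2 derive1E].
Qed.

End Pressure.

(** * Reduction of the multidimensional system to two scalar equations *)

Section Planar.
Context {R : realType} {d : nat}.
Implicit Types (F : R -> R) (x : 'rV[R]_d.+1).

Lemma pd_planar (j : 'I_d.+1) F x : pd j (fun y => F (y 0 0)) x =
  if j == 0 then derive1 F (x 0 0) else 0.
Proof.
rewrite /pd /derive; case: eqVneq => [->|j0].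
  rewrite /derive1 (_ : (fun h : R => _) =
    (fun h : R => h^-1 *: (F (h + x 0 0) - F (x 0 0))))//.
  by apply/funext => h /=; rewrite !mxE !eqxx mulr1.
under eq_fun do
  rewrite /= !mxE eqxx /= eq_sym (negbTE j0) mulr0 add0r subrr scaler0.
exact: lim_cst.
Qed.

Lemma differentiable_planar F x : derivable F (x 0 0) 1 ->
  differentiable (fun y : 'rV[R]_d.+1 => F (y 0 0)) x.
Proof.
move=> /derivable1_diffP dF.
apply: (@differentiable_comp _ _ _ _ (fun y : 'rV[R]_d.+1 => y 0 0) F) => //.
exact: differentiable_coord.
Qed.

(** Only the first coordinate direction contributes to the divergence and to the transport term, and
    the other momentum components vanish identically. *)
Lemma euler_planar (q : R -> R) (N V Nt Nx Vt Vx qx : R -> R -> R) :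
  (forall t x : R, 0 <= t -> tquot (N^~ x) t --> Nt t x) ->
  (forall t x : R, 0 <= t -> tquot (V^~ x) t --> Vt t x) ->
  (forall t x : R, 0 <= t -> is_derive x (1 : R) (N t) (Nx t x)) ->
  (forall t x : R, 0 <= t -> is_derive x (1 : R) (V t) (Vx t x)) ->
  (forall t x : R, 0 <= t -> is_derive x (1 : R) (q \o N t) (qx t x)) ->
  (forall t x : R, 0 <= t -> Nt t x + (Nx t x * V t x + N t x * Vx t x) = 0) ->
  (forall t x : R, 0 <= t -> Vt t x + V t x * Vx t x + qx t x = 0) ->
  euler_solution q (@planar_density R d N) (@planar_velocity R d V).
Proof.
move=> HNt HVt HNx HVx Hqx eqN eqV t x t0; set y := x 0 0.
have [dN tN] := tderiveP t0 (HNt t y t0).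
have [dV tV] := tderiveP t0 (HVt t y t0).
have [dNx NxE] := HNx t y t0; have [dVx VxE] := HVx t y t0.
have [dqx qxE] := Hqx t y t0.
have UE i : (fun z => planar_velocity V t z 0 i) =
    (fun z : 'rV[R]_d.+1 => (fun u => if i == 0 then V t u else 0) (z 0 0)).
  by apply/funext => z; rewrite mxE.
have dNV : derivable (fun u => N t u * V t u) y 1 /\
    derive1 (fun u => N t u * V t u) y = Nx t y * V t y + N t y * Vx t y.
  have [d1 d2] := @is_deriveM _ _ (N t) (V t) y 1 _ _ (HNx t y t0) (HVx t y t0).
  split; first exact: d1.
  by rewrite derive1E [LHS]d2 addrC [_ *: _]mulrC.
have dU i : derivable (fun u => if i == 0 :> 'I_d.+1 then V t u else 0) y 1.
  by case: (i == 0) => //; exact: derivable_cst.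
split.
- split=> //; exact: (@differentiable_planar (N t) x dNx).
- move=> i; rewrite UE; split; last exact: (differentiable_planar (dU i)).
  have -> : (fun t' => planar_velocity V t' x 0 i) =
      (fun s => if i == 0 then V s y else 0) by apply/funext => s; rewrite mxE.
  case: (i == 0) => //.
  by have [] := tderiveP t0 (tquot_cst 0 t).
- exact: (@differentiable_planar (q \o N t) x dqx).
- apply: etrans (eqN t y t0); congr (_ + _); first exact: tN.
  have NUE j : (fun z => planar_density N t z * planar_velocity V t z 0 j) =
      (fun z => N t (z 0 0) * (if j == 0 then V t (z 0 0) else 0)).
    by apply/funext => z; rewrite mxE.
  rewrite (bigD1 0)//= big1 ?addr0 => [|j j0].
    by rewrite NUE (pd_planar 0 (fun u => N t u * V t u)) eqxx dNV.2.
  rewrite NUE (pd_planar j (fun u => N t u * if j == 0 then V t u else 0)).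
  by rewrite (negbTE j0).
- move=> i.
  have -> : (fun t' => planar_velocity V t' x 0 i) =
      (fun s => if i == 0 then V s y else 0) by apply/funext => s; rewrite mxE.
  rewrite (bigD1 0)//= big1 ?addr0 => [|j j0]; last first.
    by rewrite mxE (negbTE j0) mul0r.
  rewrite !UE !(pd_planar _ (fun u => if i == 0 then V t u else 0)) mxE eqxx /=.
  rewrite (pd_planar i (q \o N t)).
  case: (i == 0).
    by rewrite !derive1E -/y qxE [X in V t y * X]VxE [X in X + _ + _]tV eqV.
  rewrite (tderiveP t0 (tquot_cst 0 t)).2 derive1_cst; ring.
Qed.

End Planar.

(** * The profile seminorm *)

Section ProfileNorm.
Context {R : realType}.
Local Notation mu := (@lebesgue_measure R).

(* Unlike ge0_le_integral, this requires no measurability. *)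
Lemma ge0_le_integralT d (X : measurableType d) (nu : {measure set X -> \bar R})
    (f g : X -> \bar R) :
  (forall x, 0 <= f x <= g x)%E ->
  (\int[nu]_x f x <= \int[nu]_x g x)%E.
Proof.
move=> fg; have f0 x : (0 <= f x)%E by have /andP[] := fg x.
have fg' x : (f x <= g x)%E by have /andP[] := fg x.
rewrite !ge0_integralTE//; last by move=> x; exact: le_trans (fg' x).
apply: ereal_sup_le => _ [h hf <-]; exists h => // x.
exact: le_trans (fg' x).
Qed.

Definition decay (c x : R) : R := expR (- (c * `|x|)).

Lemma decay01 c x : 0 <= c -> 0 <= decay c x <= 1.
Proof.
move=> c0; rewrite expR_ge0 -[leRHS]expR0 ler_expR oppr_le0 mulr_ge0//.
Qed.

Lemma continuous_decay c : continuous (decay c).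
Proof.
move=> x; apply: continuous_comp; last exact: continuous_expR.
apply: cvgN; apply: cvgM; first exact: cvg_cst.
exact: norm_continuous.
Qed.

Lemma measurable_decay c : measurable_fun setT (decay c).
Proof. by apply: continuous_measurable_fun; exact: continuous_decay. Qed.

(** By evenness the integral is twice the one over the half line, where the exponential probability
    density is available. *)
Lemma integral_decay c : 0 < c -> (\int[mu]_x (decay c x)%:E = (2 / c)%:E)%E.
Proof.
move=> c0.
rewrite ge0_symfun_integralT; last 3 first.
- by move=> x; exact: expR_ge0.
- exact: continuous_decay.
- by move=> x; rewrite /decay /= normrN.
rewrite EFinM; congr (_ * _)%E.
(* The density c exp(-cx) has mass 1, so its multiple by 1/c has mass 1/c. *)
have <- : (\int[mu]_x ((c^-1)%:E * (exponential_pdf c x)%:E) = c^-1%:E)%E.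
  rewrite ge0_integralZl//.
  - by rewrite integral_exponential_pdf// mule1.
  - by apply/measurable_EFinP; exact: measurable_exponential_pdf.
  - by move=> x _; rewrite lee_fin exponential_pdf_ge0// ltW.
  - by rewrite lee_fin invr_ge0 ltW.
rewrite -set_itvcy integral_mkcond; apply: eq_integral => x _.
rewrite /exponential_pdf !patchE.
case: ifPn; last by rewrite mule0.
rewrite inE /= in_itv /= andbT => x0.
by rewrite -EFinM mulKf ?gt_eqF// /decay ger0_norm// mulNr.
Qed.

Lemma Lnorm_oo_le (f : R -> R) (B : R) : 0 <= B -> (forall x, `|f x| <= B) ->
  ('N[mu]_+oo[EFin \o f] <= B%:E)%E.
Proof.
(* The second case is the default value 0 of the norm on a null space. *)
move=> B0 fB; rewrite unlock; case: ifPn => _; last by rewrite lee_fin.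
by apply/ess_supP; apply: nearW => x /=; rewrite lee_fin.
Qed.

(** Since [decay] <= 1, its square is at most [decay], and the square of f is dominated by B^2
    decay(x) on the strip. By Tonelli this majorant has integral B^2 (2/c) (T - t0), independent of
    f. *)
Lemma Lnorm2_strip_le c (B t0 T : R) : 0 < c -> t0 <= T ->
  exists A : R, forall f : R -> R -> R,
    (forall t x, t0 <= t <= T -> `|f t x| <= B * decay c x) ->
    ('N[mu \x mu]_2%:E[EFin \o
       ((fun z : R * R => f z.1 z.2) \_ (`[t0, T] `*` setT))] <= A%:E)%E.
Proof.
move=> c0 t0T.
have [b b0 bE] : exists2 b, 0 <= b & b = B ^+ 2.
  by exists (B ^+ 2); rewrite ?sqr_ge0.
pose g (z : R * R) : R := \1_(`[t0, T]%classic) z.1 * (b * decay c z.2).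
have g0 z : 0 <= g z.
  by rewrite /g indicE !mulr_ge0// expR_ge0.
have mg : measurable_fun setT g.
  apply: measurable_funM.
    by apply: measurableT_comp; [exact: measurable_indic|exact: measurable_fst].
  apply: measurable_funM; first exact: measurable_cst.
  by apply: measurableT_comp; [exact: measurable_decay|exact: measurable_snd].
have [A gA] : exists A : R, (\int[mu \x mu]_z (g z)%:E = A%:E)%E.
  exists ((b * (2 / c)) * (T - t0)).
  rewrite (@fubini_tonelli1 _ _ _ _ _ mu mu (EFin \o g)); last 2 first.
  - exact/measurable_EFinP.
  - by move=> z; rewrite lee_fin.
  have B0 : 0 <= b * (2 / c) by rewrite mulr_ge0// divr_ge0// ltW.
  under eq_integral => x _.
    rewrite /fubini_F /g /=.
    under eq_integral do rewrite !EFinM.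
    rewrite ge0_integralZl//; last 2 first.
    - apply: measurable_funeM; apply/measurable_EFinP.
      exact: measurable_decay.
    - by move=> y _; rewrite -EFinM lee_fin mulr_ge0 ?expR_ge0.
    rewrite ge0_integralZl//; last 2 first.
    - by apply/measurable_EFinP; exact: measurable_decay.
    - by move=> y _; rewrite lee_fin expR_ge0.
    rewrite integral_decay// -!EFinM mulrC EFinM.
    over.
  rewrite /= ge0_integralZl//; last first.
    by apply/measurable_EFinP; exact: measurable_indic.
  rewrite integral_indic// setIT [RHS]EFinM; congr (_ * _)%E.
  have := @lebesgue_measure_itv R `[t0, T]; rewrite /= lte_fin.
  move: t0T; rewrite le_eqVlt => /predU1P[->|->] H; rewrite [LHS]H ?EFinB//.
  by rewrite ltxx subee.
exists (A `^ 2^-1) => f fB.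
rewrite unlock /= -poweR_EFin -gA; apply: gt0_ler_poweR.
- by rewrite invr_ge0.
- by rewrite in_itv /= leey andbT integral_ge0// => z _; exact: poweR_ge0.
- by rewrite in_itv /= leey andbT integral_ge0// => z _; rewrite lee_fin.
apply: ge0_le_integralT => z /=; rewrite !lee_fin powR_ge0/=.
rewrite powR_mulrn// patchE /g indicE in_setX in_setT andbT.
case: ifPn => zI; last by rewrite normr0 expr0n mul0r.
rewrite mul1r bE; move: zI; rewrite inE /= in_itv /= => zI.
have /andP[d0 d1] := decay01 z.2 (ltW c0).
rewrite (@le_trans _ _ ((B * decay c z.2) ^+ 2))//.
  by rewrite lerXn2r// ?nnegrE//; [exact: le_trans (fB _ _ zI)|exact: fB].
by rewrite exprMn ler_wpM2l ?sqr_ge0// expr2 ler_piMl.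
Qed.

(** Each L^2 term has at least one x-derivative, applied first, so it is a derivative of order at
    most m of [dx f] and is square integrable by decay. The sup terms, which include [f] itself,
    need boundedness only. *)
Lemma Xnorm_le I m c t0 T (f : I -> R -> R -> R) :
  0 < c -> 0 <= t0 -> t0 <= T ->
  Ck_dominated T m (cst 1) f ->
  Ck_dominated T m (decay c) (fun i => dx (f i)) ->
  exists A : R, forall i, (Xnorm m t0 T (f i) <= A%:E)%E.
Proof.
move=> c0 t00 t0T kf kfx.
have sup_le (ab : 'I_m.+1 * 'I_m.+1) : (ab.1 + ab.2 <= m)%N ->
    exists A : R, forall i, (ereal_sup [set 'N[mu]_+oo[EFin \o
      dtx ab.1 ab.2 (f i) t] | t in `[t0, T]] <= A%:E)%E.
  move=> abm; have [B HB] := dtx_dominated kf abm; exists `|B| => i.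
  apply: ge_ereal_sup => _ [t /= + <-]; rewrite in_itv /= => /andP[tl tT].
  apply: Lnorm_oo_le => // x; have := HB i t x.
  rewrite (le_trans t00 tl) tT mulr1 => /(_ isT) /le_trans; apply.
  exact: ler_norm.
have int_le (ab : 'I_m.+1 * 'I_m.+1) : (ab.1 + ab.2 <= m)%N ->
    exists A : R, forall i, ('N[mu \x mu]_2%:E[EFin \o
        ((fun z : R * R => dtx ab.1 ab.2.+1 (f i) z.1 z.2)
           \_ (`[t0, T] `*` setT))] <= A%:E)%E.
  move=> abm; have [B HB] := dtx_dominated kfx abm.
  have [A HA] := Lnorm2_strip_le B c0 t0T; exists A => i.
  apply: HA => t x /andP[tl tT]; rewrite /dtx iterSr; apply: HB.
  by rewrite (le_trans t00 tl).
have sum_le (F : I -> 'I_m.+1 * 'I_m.+1 -> \bar R) :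
    (forall ab : 'I_m.+1 * 'I_m.+1, (ab.1 + ab.2 <= m)%N ->
      exists A : R, forall i, (F i ab <= A%:E)%E) ->
    exists A : R, forall i,
      (\sum_(ab : 'I_m.+1 * 'I_m.+1 | (ab.1 + ab.2 <= m)%N) F i ab <= A%:E)%E.
  move=> HF.
  have /choice[A HA] : forall ab : 'I_m.+1 * 'I_m.+1, exists A : R,
      (ab.1 + ab.2 <= m)%N -> forall i, (F i ab <= A%:E)%E.
    move=> ab; case: (boolP (ab.1 + ab.2 <= m)%N) => [/HF[A HA]|_].
      by exists A.
    by exists 0.
  exists (\sum_(ab : 'I_m.+1 * 'I_m.+1 | (ab.1 + ab.2 <= m)%N) A ab) => i.
  by rewrite -sumEFin; apply: lee_sum => ab abm; exact: HA.
have [A1 H1] := sum_le _ sup_le; have [A2 H2] := sum_le _ int_le.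
by exists (A1 + A2) => i; rewrite EFinD; exact: (leeD (H1 i) (H2 i)).
Qed.

End ProfileNorm.

(** * The rarefaction profile *)

Section ProfileFamily.
Context {R : realType} {I : Type}.
Variables (p : R -> R) (nlo nhi plo : R) (k : bool) (m : nat).
Variables (c : R) (C : nat -> R) (T B lamB : R).
Variables (e : I -> (R * R) * (R * R)) (w0 : I -> R -> R).
Variables (w N V : I -> R -> R -> R) (G1 G2 : I -> R -> R).
Local Notation lam := (lambda p k).

Hypothesis hp : pressure_assumption m.+1 nlo nhi plo p.
Hypothesis c0 : 0 < c.
Hypothesis e_regime : forall i, rarefaction_regime m.+1 p nlo nhi k (e i).
Hypothesis w0_datum : forall i,
  burgers_datum m c C (lam (e i).1) (lam (e i).2) (w0 i).
Hypothesis w_sol : forall i, burgers_solution (w0 i) (w i).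
Hypothesis NV_profile : forall i,
  rarefaction_profile p nlo k (e i).1 (e i).2 (w i) (N i) (V i).
Hypothesis G_coord : forall i, coordinate p nlo k m.+1 (e i) (G1 i) (G2 i).
Hypothesis G_bound : forall i y, lam (e i).1 <= y <= lam (e i).2 ->
  derive_bound m.+1 (G1 i) (G2 i) B y.
Hypothesis lam_bound : forall i,
  `|lam (e i).1| <= lamB /\ `|lam (e i).2| <= lamB.

Lemma w0_range i x : lam (e i).1 <= w0 i x <= lam (e i).2.
Proof.
have [_ [mono _] [wNy wy] _ _] := w0_datum i; apply/andP; split.
  apply: (@closed_cvg _ _ (-oo%R) _ (w0 i) (fun v => v <= w0 i x) _ _ _ wNy).
    exact: closed_le.
  near=> y; apply: mono; near: y; exact: (nbhs_ninfty_le (num_real _)).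
apply: (@closed_cvg _ _ (+oo%R) _ (w0 i) (fun v => w0 i x <= v) _ _ _ wy).
  exact: closed_ge.
near=> y; apply: mono; near: y; exact: (nbhs_pinfty_ge (num_real _)).
Unshelve. all: by end_near. Qed.

Lemma le_range_norm i y : lam (e i).1 <= y <= lam (e i).2 -> `|y| <= lamB.
Proof.
move=> /andP[ly yl]; have [l1 l2] := lam_bound i.
rewrite ler_norml; apply/andP; split.
  by apply: le_trans ly; move: l1; rewrite ler_norml => /andP[].
by apply: le_trans yl _; move: l2; rewrite ler_norml => /andP[].
Qed.

Lemma w0_le i x : `|w0 i x| <= lamB.
Proof. exact: le_range_norm (w0_range i x). Qed.

Lemma w0_bounded : exists B : R, forall i x, `|w0 i x| <= B.
Proof. by exists lamB => i x; exact: w0_le. Qed.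

Lemma w0_Ck i n : Ck n (w0 i).
Proof. by have [] := w0_datum i. Qed.

Lemma w_w0 i t x : 0 <= t -> w i t x = w0 i (foot w i t x).
Proof. exact: (w_foot w0_Ck w0_bounded w_sol). Qed.

Lemma w_range i t x : 0 <= t -> lam (e i).1 <= w i t x <= lam (e i).2.
Proof. by move=> t0; rewrite w_w0//; exact: w0_range. Qed.

Lemma w_le i t x : 0 <= t -> `|w i t x| <= lamB.
Proof. by move=> t0; apply: le_range_norm (w_range i x t0). Qed.

(** For j >= 1 the end state subtracted in the tail estimate drops out, so both half lines give the
    same bound. The sum of the |C l| replaces [C j] by one constant for all orders, and the jump of
    lambda_k is at most 2 [lamB]. *)
Lemma w0_tail i j x : (0 < j <= m.+1)%N ->
  `|derive1n j (w0 i) x| <=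
    (\sum_(l < m.+2) `|C l|) * (lamB + lamB) * expR (- (c * `|x|)).
Proof.
move=> /andP[j0 jm]; have [_ _ _ _ tails] := w0_datum i.
have Cj : C j <= \sum_(l < m.+2) `|C l|.
  rewrite (bigD1 (Ordinal (jm : (j < m.+2)%N)))//=.
  by rewrite (le_trans (ler_norm _))// lerDl sumr_ge0.
have lam_le := ltW (regime_lambda (e_regime i)).
have dlam : 0 <= lam (e i).2 - lam (e i).1 <= lamB + lamB.
  rewrite subr_ge0 lam_le /=; have [l1 l2] := lam_bound i.
  apply: lerD; first exact: le_trans (ler_norm _) l2.
  by apply: le_trans (ler_norm _) _; rewrite normrN.
have main v : `|derive1n j (fun y => w0 i y - v) x| <=
    C j * (lam (e i).2 - lam (e i).1) * expR (- (c * `|x|)) ->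
  `|derive1n j (w0 i) x| <=
    (\sum_(l < m.+2) `|C l|) * (lamB + lamB) * expR (- (c * `|x|)).
  case: j j0 jm Cj tails => // j _ jm Cj tails.
  rewrite (derive1nS_addC j (w0 i)) => /le_trans; apply.
  rewrite ler_wpM2r ?expR_ge0//; case/andP: dlam => d0 d1.
  rewrite (@le_trans _ _
    ((\sum_(l < m.+2) `|C l|) * (lam (e i).2 - lam (e i).1)))//.
    by rewrite ler_wpM2r.
  by rewrite ler_wpM2l// sumr_ge0.
have [tr tl] := tails j x jm.
by have [x0|x0] := leP 0 x; [apply: main (tr x0)|apply: main (tl (ltW x0))].
Qed.

(** The foot is within T [lamB] of x, so decay at the foot is decay at x up to the factor exp(c T
    lamB). *)
Lemma w0_foot_decay : exists B : R, forall i j (t x : R), (0 < j <= m.+1)%N ->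
  0 <= t <= T -> `|derive1n j (w0 i) (foot w i t x)| <= B * decay c x.
Proof.
exists ((\sum_(l < m.+2) `|C l|) * (lamB + lamB) * expR (c * (T * lamB))).
move=> i j t x jm /andP[t0 tT]; apply: le_trans (w0_tail _ _ jm) _.
have lamB0 : 0 <= lamB by exact: le_trans (normr_ge0 _) (w0_le i 0).
rewrite -[leRHS]mulrA ler_wpM2l//.
  by rewrite mulr_ge0 ?sumr_ge0 ?addr_ge0.
have xfoot : `|x| <= `|foot w i t x| + T * lamB.
  rewrite /foot -[x in `|x| <= _](subrK (t * w i t x)).
  rewrite (le_trans (ler_normD _ _))// lerD2l normrM ger0_norm//.
  by rewrite ler_pM// w_le.
rewrite /decay -expRD ler_expR.
by have := ler_wpM2l (ltW c0) xfoot; rewrite mulrDr; lra.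
Qed.

Lemma NV_coord i t x : 0 <= t ->
  N i t x = G1 i (w i t x) /\ V i t x = G2 i (w i t x).
Proof.
move=> t0; have [cz lz] := NV_profile i x t0.
have [_ _ _ /(_ _ cz)[_]] := G_coord i.
by rewrite lz => -[-> ->].
Qed.

Lemma NV_density i t x : 0 <= t -> nlo < N i t x < nhi.
Proof.
move=> t0; have [cz _] := NV_profile i x t0.
exact: (regime_density (e_regime i) cz).
Qed.

Lemma G1_bound : exists B' : R, forall i j t x, (j <= m.+1)%N -> 0 <= t <= T ->
  `|derive1n j (G1 i) (w i t x)| <= B'.
Proof.
exists B => i j t x jm /andP[t0 _].
by have [] := G_bound (w_range i x t0) jm.
Qed.

Lemma G2_bound : exists B' : R, forall i j t x, (j <= m.+1)%N -> 0 <= t <= T ->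
  `|derive1n j (G2 i) (w i t x)| <= B'.
Proof.
have [Bc Hc] := cq_bounded hp.
exists (Num.max B (lamB + Bc)) => i [|j] t x jm /andP[t0 _]; last first.
  by have [_ /(_ isT)] := G_bound (w_range i x t0) jm; rewrite le_max => ->.
(* [derive_bound] leaves out the order 0 of the second coordinate. That value is V = w - sgn k
   c_q(N), bounded because the densities stay between [nlo] and [nhi]. *)
rewrite le_max; apply/orP; right => /=.
have [_ <-] := NV_coord i x t0; have [cz lz] := NV_profile i x t0.
have -> : V i t x = w i t x - sgn k * cq p (N i t x).
  by rewrite -lz /lambda /= addrK.
rewrite (le_trans (ler_normB _ _))// lerD ?w_le// normrM.
rewrite norm_sgn mul1r.
by apply: Hc; have /andP[? ?] := NV_density i x t0; rewrite !ltW.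
Qed.

Lemma comp_w_dominated (f : I -> R -> R -> R) (G : I -> R -> R) :
  (forall i, Ck m.+1 (G i)) ->
  (exists B' : R, forall i j t x, (j <= m.+1)%N -> 0 <= t <= T ->
    `|derive1n j (G i) (w i t x)| <= B') ->
  (forall i t x, 0 <= t -> f i t x = G i (w i t x)) ->
  Ck_dominated T m.+1 (cst 1) f /\
  Ck_dominated T m (decay c) (fun i => dx (f i)).
Proof.
move=> CkG bG fG; have E01 x := decay01 x (ltW c0).
have w0m i x : 0 <= derive1 (w0 i) x by have [_ []] := w0_datum i.
have [kw kwt kwx] :=
  burgers_dominated E01 w0_Ck w0m w0_bounded w0_foot_decay w_sol.
have [|kf /(_ _ erefl)[_ kfx]] := Ck_dominated_comp E01 CkG bG kw.
  by move=> _ [<-].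
split.
  by apply: eq_Ck_dominated kf => i t x t0; rewrite fG.
apply: eq_Ck_dominated kfx => i t x t0; rewrite /dx.
by congr (derive1 _ x); apply/funext => y; rewrite fG.
Qed.

Lemma N_dominated : Ck_dominated T m.+1 (cst 1) N /\
  Ck_dominated T m (decay c) (fun i => dx (N i)).
Proof.
apply: (comp_w_dominated _ G1_bound).
  by move=> i; have [] := G_coord i.
by move=> i t x t0; have [] := NV_coord i x t0.
Qed.

Lemma V_dominated : Ck_dominated T m.+1 (cst 1) V /\
  Ck_dominated T m (decay c) (fun i => dx (V i)).
Proof.
apply: (comp_w_dominated _ G2_bound).
  by move=> i; have [] := G_coord i.
by move=> i t x t0; have [] := NV_coord i x t0.
Qed.

(** The foot differs from x by at most t [lamB]. *)
Lemma foot_cvg_infty i t : 0 <= t ->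
  foot w i t x @[x --> -oo] --> -oo /\ foot w i t x @[x --> +oo] --> +oo.
Proof.
move=> t0; split.
  apply/cvgrNyPle => A; near=> x; rewrite /foot.
  have := w_le i x t0; rewrite ler_norml => /andP[wl _].
  rewrite lerBlDr -lerBlDl.
  rewrite (@le_trans _ _ (- (t * lamB)))//.
    rewrite lerBlDl; near: x; exact: (nbhs_ninfty_le (num_real _)).
  by rewrite -mulrN ler_wpM2l.
apply/cvgryPge => A; near=> x; rewrite /foot.
have := w_le i x t0; rewrite ler_norml => /andP[_ wl].
rewrite lerBrDr (@le_trans _ _ (A + t * lamB))//.
by rewrite lerD2l ler_wpM2l.
Unshelve. all: by end_near. Qed.

Lemma NV_cvg i t : 0 <= t ->
  [/\ N i t x @[x --> -oo] --> (e i).1.1, V i t x @[x --> -oo] --> (e i).1.2,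
      N i t x @[x --> +oo] --> (e i).2.1 & V i t x @[x --> +oo] --> (e i).2.2].
Proof.
move=> t0; have [fNy fy] := foot_cvg_infty i t0.
have [_ _ [w0Ny w0y] _ _] := w0_datum i.
have wNy : w i t x @[x --> -oo] --> lam (e i).1.
  by under eq_fun do rewrite w_w0//; exact: cvg_comp fNy w0Ny.
have wy : w i t x @[x --> +oo] --> lam (e i).2.
  by under eq_fun do rewrite w_w0//; exact: cvg_comp fy w0y.
have [[_ cG1] [_ cG2] _ Gz] := G_coord i.
(* The end states are the values of the coordinates at the end values of lambda_k, so continuity of
   the coordinates yields the limits. *)
have [_ z1] := Gz _ (@curve_left _ p nlo k (e i)).
have [_ z2] := Gz _ (regime_curve_right (e_regime i)).
have N1 := f_equal fst z1; have V1 := f_equal snd z1.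
have N2 := f_equal fst z2; have V2 := f_equal snd z2.
rewrite /= in N1 V1 N2 V2; rewrite N1 V1 N2 V2.
have NE : N i t = G1 i \o w i t by apply/funext => x; case: (NV_coord i x t0).
have VE : V i t = G2 i \o w i t by apply/funext => x; case: (NV_coord i x t0).
rewrite NE VE; split.
- exact: cvg_comp wNy (cG1 0%N isT _).
- exact: cvg_comp wNy (cG2 0%N isT _).
- exact: cvg_comp wy (cG1 0%N isT _).
- exact: cvg_comp wy (cG2 0%N isT _).
Qed.

Lemma NV_euler d q i : effective_enthalpy nlo nhi p q ->
  euler_solution q (@planar_density R d (N i)) (@planar_velocity R d (V i)).
Proof.
move=> hq.
pose rho := riemann p nlo (~~ k) (e i).1.
pose nu t x := cq p (N i t x) / N i t x.
pose Nx t x := derive1 (G1 i) (w i t x) * dx (w i) t x.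
have [CkG1 _ _ _] := G_coord i; have [dG1 _ _] := Ck_derive1 CkG1.
(* The invariant is that of the opposite family, whose sign is reversed; solving it for V exhibits
   V_x as a multiple of N_x, which the coordinate [G2] would not show. *)
have VE t x : 0 <= t -> V i t x = rho + sgn k * sound_primitive nlo p (N i t x).
  move=> t0; have [[_ Rz] _] := NV_profile i x t0.
  rewrite /rho -Rz /riemann /= -/(sound_primitive nlo p _) /sgn.
  by case: (k) => /=; ring.
have HNt t x : 0 <= t -> tquot ((N i)^~ x) t --> - w i t x * Nx t x.
  move=> t0; have [wt _] := w_diff w_sol i x t0.
  have Nt := tquot_comp wt (dG1 (w i t x)).
  apply: (@eq_tquot _ (fun s => G1 i (w i s x))) => //.
    by move=> s s0; case: (NV_coord i x s0).
  by apply: tquot_eq Nt _; rewrite /Nx; ring.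
have HNx t x : 0 <= t -> is_derive x (1 : R) (N i t) (Nx t x).
  move=> t0; have [_ wx] := w_diff w_sol i x t0.
  rewrite (_ : N i t = G1 i \o w i t); last first.
    by apply/funext => y; case: (NV_coord i y t0).
  exact: is_derive1_comp (dG1 _) wx.
have HVt t x : 0 <= t ->
    tquot ((V i)^~ x) t --> sgn k * (nu t x * (- w i t x * Nx t x)).
  move=> t0; have dS := is_derive_sound_primitive hp (NV_density i x t0).
  have := tquotD (tquot_cst rho t)
    (tquotM (tquot_cst (sgn k) t) (tquot_comp (HNt t x t0) dS)).
  move=> Vt; apply: (@eq_tquot _
    (fun s => rho + sgn k * sound_primitive nlo p (N i s x))) => //.
    by move=> s s0; rewrite VE.
  by apply: tquot_eq Vt _; rewrite /= /nu; ring.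
have HVx t x : 0 <= t ->
    is_derive x (1 : R) (V i t) (sgn k * (nu t x * Nx t x)).
  move=> t0; have dS := is_derive_sound_primitive hp (NV_density i x t0).
  rewrite (_ : V i t =
    cst rho + sgn k \*: (sound_primitive nlo p \o N i t)); last first.
    by apply/funext => y; rewrite VE.
  have := is_deriveD (is_derive_cst rho x (1 : R))
    (is_deriveZ (sgn k) (is_derive1_comp dS (HNx t x t0))).
  by move=> /is_derive_val; apply; rewrite add0r.
have Nden t x (t0 : 0 <= t) : N i t x \in `]nlo / 4, 2 * nhi[.
  apply: (density_interior hp).
  by have /andP[? ?] := NV_density i x t0; rewrite !ltW.
have N0 t x (t0 : 0 <= t) : N i t x != 0.
  have [nlo0 _ _ _ _] := hp; have /andP[Nl _] := NV_density i x t0.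
  by rewrite gt_eqF// (lt_trans nlo0).
have Hqx t x : 0 <= t -> is_derive x (1 : R) (q \o N i t)
    ((enthalpy' p (N i t x) + (N i t x)^-1) * Nx t x).
  by move=> t0; apply: is_derive1_comp (hq _ (Nden t x t0)) (HNx t x t0).
have lamE t x (t0 : 0 <= t) : w i t x = V i t x + sgn k * cq p (N i t x).
  by have [_ <-] := NV_profile i x t0.
apply: (euler_planar HNt HVt HNx HVx Hqx) => t x t0.
  by rewrite lamE// /nu; have := N0 t x t0 => Nn0; field.
rewrite lamE// /nu /enthalpy'.
(* With p' = c_q^2 - 1 and w = V + sgn k c_q, the left side of the momentum equation becomes (1 -
   (sgn k)^2) c_q^2 N_x / N. *)
have /eqP := cq_sqr hp (Nden t x t0); rewrite -subr_eq => /eqP <-.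
have s2 : sgn k * sgn k = 1 :> R by rewrite /sgn; case: (k); ring.
have Nn0 := N0 t x t0.
rewrite [LHS](_ : _ =
  (1 - sgn k * sgn k) * (cq p (N i t x) ^+ 2 / N i t x * Nx t x)).
  by rewrite s2 subrr mul0r.
by field.
Qed.

End ProfileFamily.

(** * Uniform constants over compact sets of end states *)

Section RegimeBounds.
Context {R : realType}.
Variables (p : R -> R) (nlo nhi plo : R) (k : bool) (m : nat).
Implicit Types (K : set ((R * R) * (R * R))) (e : (R * R) * (R * R)).
Local Notation lam := (lambda p k).
Local Notation regime := (rarefaction_regime m.+1 p nlo nhi k).

Hypothesis hp : pressure_assumption m.+1 nlo nhi plo p.

Lemma near_normS (f : (R * R) * (R * R) -> R) e : {for e, continuous f} ->
  \forall e' \near e, `|f e'| <= `|f e| + 1.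
Proof.
move=> cf; have cn : `|f e'| @[e' --> e] --> `|f e| by exact: cvg_norm cf.
have f1 : `|f e| < `|f e| + 1 by rewrite ltrDl.
have H : \forall e' \near e, `|f e'| < `|f e| + 1 by exact: cn _ (lt_nbhsl f1).
by apply: filterS H => e' /ltW.
Qed.

(** In lambda_k = V + sgn k c_q(N) the velocity is locally bounded and c_q is bounded on [nlo, nhi],
    which contains all densities of the regime. *)
Lemma compact_lambda_bounded K : compact K -> K `<=` regime ->
  exists B : R, forall e, K e -> `|lam e.1| <= B /\ `|lam e.2| <= B.
Proof.
move=> cK Kr; apply: (compact_near_bounded cK) => [B B' e BB [h1 h2]|e Ke].
  by split; [exact: le_trans h1 BB|exact: le_trans h2 BB].
have [Bc Hc] := cq_bounded hp.
have lam_le z M : nlo <= z.1 <= nhi -> `|z.2| <= M -> `|lam z| <= M + Bc.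
  move=> zI zM; rewrite (le_trans (ler_normD _ _))// lerD// normrM.
  by rewrite norm_sgn mul1r Hc.
exists (Num.max (`|e.1.2| + 1) (`|e.2.2| + 1) + Bc).
have c1 : {for e, continuous (fun e : (R * R) * (R * R) => e.1.2)}.
  exact: (cvg_comp _ _ cvg_fst cvg_snd).
have c2 : {for e, continuous (fun e : (R * R) * (R * R) => e.2.2)}.
  exact: (cvg_comp _ _ cvg_snd cvg_snd).
move: (near_normS c1) (near_normS c2); apply: filterS2 => e' h1 h2 Ke'.
have re' := Kr _ Ke'.
have n1 := regime_density re' (curve_left _ _ _ _).
have n2 := regime_density re' (regime_curve_right re').
split; apply: lam_le.
- by have /andP[? ?] := n1; rewrite !ltW.
- by rewrite le_max h1.
- by have /andP[? ?] := n2; rewrite !ltW.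
- by rewrite le_max h2 orbT.
Qed.

Lemma strength_cont :
  continuous (fun e : (R * R) * (R * R) => strength e.1 e.2).
Proof.
move=> e; apply: cvgD; apply: cvg_norm; apply: cvgB.
- exact: (cvg_comp _ _ cvg_snd cvg_fst).
- exact: (cvg_comp _ _ cvg_fst cvg_fst).
- exact: (cvg_comp _ _ cvg_snd cvg_snd).
- exact: (cvg_comp _ _ cvg_fst cvg_snd).
Qed.

Lemma strength_ge0 e : 0 <= strength e.1 e.2.
Proof. by rewrite addr_ge0. Qed.

(** The strength is continuous and positive, because the two end densities differ. The form 1 <= B *
    strength lets any uniform constant be multiplied by the strength. *)
Lemma compact_strength_bounded K : compact K -> K `<=` regime ->
  exists B : R, forall e, K e -> 1 <= B * strength e.1 e.2.
Proof.
move=> cK Kr; apply: (compact_near_bounded cK) => [B B' e BB h|e Ke].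
  by apply: le_trans h _; rewrite ler_wpM2r// strength_ge0.
have s0 : 0 < strength e.1 e.2.
  rewrite ltr_pwDl// normr_gt0 subr_eq0 eq_sym.
  exact: regime_neq (Kr _ Ke).
have s2 : strength e.1 e.2 / 2 < strength e.1 e.2.
  by rewrite ltr_pdivrMr// ltr_pMr// ltr1n.
exists ((strength e.1 e.2 / 2)^-1).
have H : \forall e' \near e, strength e.1 e.2 / 2 < strength e'.1 e'.2.
  exact: (@strength_cont e _ (lt_nbhsr s2)).
apply: filterS H => e' h _.
by rewrite mulrC ler_pdivlMr ?mul1r ?divr_gt0// ltW.
Qed.

Lemma compact_coordinate_bounded K : compact K -> K `<=` regime ->
  exists B : R, forall e, K e -> bounded_coordinate p nlo k m.+1 B e.
Proof.
move=> cK Kr; apply: (compact_near_bounded cK) => [B B' e|e Ke].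
  exact: bounded_coordinateW.
exact: regime_near_bounded Kr Ke.
Qed.

(** Serves as the index type of the dominated families: all profiles sharing the same constants form
    one family, so a bound for that family is a uniform bound. *)
Record bounded_profile (c : R) (C : nat -> R) (B lamB : R) := BoundedProfile {
  profile_ends : (R * R) * (R * R);
  profile_w0 : R -> R;
  profile_w : R -> R -> R;
  profile_N : R -> R -> R;
  profile_V : R -> R -> R;
  profile_G1 : R -> R;
  profile_G2 : R -> R;
  profile_regime : regime profile_ends;
  profile_datum :
    burgers_datum m c C (lam profile_ends.1) (lam profile_ends.2) profile_w0;
  profile_sol : burgers_solution profile_w0 profile_w;
  profile_states :
    rarefaction_profile p nlo k profile_ends.1 profile_ends.2
      profile_w profile_N profile_V;
  profile_coord : coordinate p nlo k m.+1 profile_ends profile_G1 profile_G2;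
  profile_bound : forall y, lam profile_ends.1 <= y <= lam profile_ends.2 ->
    derive_bound m.+1 profile_G1 profile_G2 B y;
  profile_lam :
    `|lam profile_ends.1| <= lamB /\ `|lam profile_ends.2| <= lamB }.

Section BoundedProfile.
Variables (c : R) (C : nat -> R) (B lamB : R).
Hypothesis c0 : 0 < c.
Local Notation datum := (bounded_profile c C B lamB).

Let profile_dominated T :=
  (N_dominated T c0 (fun i : datum => profile_regime i)
     (fun i => profile_datum i)
     (fun i => profile_sol i) (fun i => profile_states i)
     (fun i => profile_coord i)
     (fun i => @profile_bound _ _ _ _ i) (fun i => profile_lam i),
   V_dominated T hp c0 (fun i : datum => profile_regime i)
     (fun i => profile_datum i)
     (fun i => profile_sol i) (fun i => profile_states i)
     (fun i => profile_coord i)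
     (fun i => @profile_bound _ _ _ _ i) (fun i => profile_lam i)).

Lemma profile_Xnorm2_le t0 T : 0 <= t0 -> t0 <= T ->
  exists A : R, forall i : datum,
    (Xnorm2 m t0 T (profile_N i) (profile_V i) <= A%:E)%E.
Proof.
move=> t00 t0T; have [[kN kNx] [kV kVx]] := profile_dominated T.
have [A1 H1] := Xnorm_le c0 t00 t0T (Ck_dominatedW (leqnSn m) kN) kNx.
have [A2 H2] := Xnorm_le c0 t00 t0T (Ck_dominatedW (leqnSn m) kV) kVx.
by exists (A1 + A2) => i; rewrite EFinD; exact: (leeD (H1 i) (H2 i)).
Qed.

Lemma profile_Ck_strip (i : datum) :
  Ck_strip m.+1 (profile_N i) /\ Ck_strip m.+1 (profile_V i).
Proof.
(* Any T would do: the regularity contained in [Ck_dominated] concerns all t >= 0, and only the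
   bounds depend on T. *)
have [[kN _] [kV _]] := profile_dominated 0.
by split; [exact: (Ck_dominated_strip i kN)|exact: (Ck_dominated_strip i kV)].
Qed.

Lemma profile_euler d q (i : datum) : effective_enthalpy nlo nhi p q ->
  euler_solution q (@planar_density R d (profile_N i))
    (@planar_velocity R d (profile_V i)).
Proof.
exact: (NV_euler hp (fun i : datum => profile_regime i) (fun i => profile_sol i)
  (fun i => profile_states i) (fun i => profile_coord i)).
Qed.

Lemma profile_cvg (i : datum) t : 0 <= t ->
  [/\ profile_N i t x @[x --> -oo] --> (profile_ends i).1.1,
      profile_V i t x @[x --> -oo] --> (profile_ends i).1.2,
      profile_N i t x @[x --> +oo] --> (profile_ends i).2.1
    & profile_V i t x @[x --> +oo] --> (profile_ends i).2.2].
Proof.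
exact: (NV_cvg (fun i : datum => profile_regime i)
     (fun i => profile_datum i)
  (fun i => profile_sol i) (fun i => profile_states i)
     (fun i => profile_coord i)
  (fun i => profile_lam i)).
Qed.

End BoundedProfile.

End RegimeBounds.

(** * Exactness of the profile and its uniform seminorm bound *)

Theorem proposition5p1 (R : realType) (d s M : nat) (nlo nhi plo : R)
    (p q : R -> R) (k : bool) (delta0 : R)
    (hs : (5 <= s)%N)
    (hp : pressure_assumption (s + 3 * M + 6) nlo nhi plo p)
    (hq : effective_enthalpy nlo nhi p q)
    (hdelta0 : 0 < delta0) :
  (forall (c : R) (C : nat -> R) (zm zp : R * R) (w0 : R -> R)
      (w N V : R -> R -> R), 0 < c ->
    rarefaction_data (s + 3 * M + 5) p nlo nhi k delta0 c C zm zp w0 w N V ->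
    [/\ Ck_strip (s + 3 * M + 6) N /\ Ck_strip (s + 3 * M + 6) V,
        euler_solution q (@planar_density R d N) (@planar_velocity R d V),
        forall t, 0 <= t ->
          [/\ N t x @[x --> -oo] --> zm.1, V t x @[x --> -oo] --> zm.2,
              N t x @[x --> +oo] --> zp.1 & V t x @[x --> +oo] --> zp.2]
      & forall t x, 0 <= t -> nlo <= N t x <= nhi]) /\
  (forall (K : set ((R * R) * (R * R))) (c : R) (C : nat -> R) (t0 T : R),
    compact K -> K `<=` rarefaction_regime (s + 3 * M + 6) p nlo nhi k ->
    0 < c -> 0 <= t0 -> t0 < T ->
    exists CtT : R, forall (zm zp : R * R) (w0 : R -> R) (w N V : R -> R -> R),
      K (zm, zp) ->
      rarefaction_data (s + 3 * M + 5) p nlo nhi k delta0 c C zm zp w0 w N V ->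
      (Xnorm2 (s + 3 * M + 5) t0 T N V <= (CtT * strength zm zp)%:E)%E).
Proof.
have mE : (s + 3 * M + 6 = (s + 3 * M + 5).+1)%N by rewrite addnS.
rewrite mE in hp *; set m := (s + 3 * M + 5)%N in hp *.
have bounds K : compact K -> K `<=` rarefaction_regime m.+1 p nlo nhi k ->
    exists B lamB : R, forall e, K e -> bounded_coordinate p nlo k m.+1 B e /\
      `|lambda p k e.1| <= lamB /\ `|lambda p k e.2| <= lamB.
  move=> cK Kr; have [B HB] := compact_coordinate_bounded cK Kr.
  have [lamB Hl] := compact_lambda_bounded hp cK Kr.
  by exists B, lamB => e Ke; split; [exact: HB|exact: Hl].
split.
  move=> c C zm zp w0 w N V c0 [re _ datum sol prof].
  (* The qualitative claims concern a single profile, for which the compact set is the singleton of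
     its end states. *)
  have [||B [lamB /(_ _ erefl)[[G1 [G2 [coord bnd]]] lamle]]] :=
    bounds [set (zm, zp)].
  - exact: compact_set1.
  - by move=> _ ->.
  pose i := BoundedProfile (B := B) (lamB := lamB)
    re datum sol prof coord bnd lamle.
  split.
  - exact: (profile_Ck_strip hp c0 i).
  - apply: (profile_euler hp i hq).
  - by move=> t t0; exact: (profile_cvg i t0).
  - move=> t x t0; have [cz _] := prof t x t0.
    by have /andP[? ?] := regime_density re cz; rewrite !ltW.
move=> K c C t0 T cK Kr c0 t00 t0T.
have [B [lamB HB]] := bounds K cK Kr.
have [S HS] := compact_strength_bounded cK Kr.
have [A HA] := profile_Xnorm2_le k hp C B lamB c0 t00 (ltW t0T).
(* A bounds the seminorm on all of K, and 1 <= S * strength makes it linear in the strength; the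
   absolute value covers a negative A. *)
exists (`|A| * S) => zm zp w0 w N V Kz [re _ datum sol prof].
have [[G1 [G2 [coord bnd]]] lamle] := HB _ Kz.
have := HA (BoundedProfile (B := B) (lamB := lamB)
  re datum sol prof coord bnd lamle).
move=> /le_trans; apply; rewrite lee_fin -mulrA.
by rewrite (le_trans (ler_norm A))// ler_peMr//; exact: (HS _ Kz).
Qed.
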